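(* Let $q$ be even, let $Q^+(5,q)$ be a hyperbolic (Klein) quadric in $\mathrm{PG}(5,q)$ with associated symplectic polarity $\zeta$, let $\Pi$ be a $3$-dimensional subspace with $\Pi\cap Q^+(5,q)=Q^-(3,q)$ an elliptic quadric, let $W(q)$ be the generalized quadrangle of points of $\Pi$ and lines of $\Pi$ meeting $Q^-(3,q)$ in exactly one point, and let $O\neq Q^-(3,q)$ be an ovoid of $W(q)$. For $x\in\Pi\setminus Q^-(3,q)$ let $\pi_x$ be the plane of $\Pi$ containing all lines of $W(q)$ through $x$ and $\mathcal{C}_x:=\pi_x^\zeta\cap Q^+(5,q)$. Then the set \[ X:=\Big(\bigcup_{x\in O\setminus Q^-(3,q)}\mathcal{C}_x\Big)\cup\big(O\cap Q^-(3,q)\big) \] is a generalized quadratic set of type (SC) of $Q^+(5,q)$ satisfying properties (1) and (2) below: (1) every plane of $Q^+(5,q)$ through a point of $A_1$ has type (S); (2) every plane $\pi$ of $Q^+(5,q)$ through a point $x\in A_2$ has type (C) and $x$ is the kernel of the oval $\pi\cap X$. Here $A_1$ is the set of points of $X$ contained in some plane of type (S), and $A_2$ is the set of kernels of the ovals $\pi\cap X$ with $\pi$ a plane of type (C).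
   Context: $\zeta$ is the symplectic polarity associated with the bilinear form of the quadratic form defining $Q^+(5,q)$. An ovoid of $W(q)$ is a set of points of $\Pi$ meeting every line of $W(q)$ in exactly one point. A generalized quadratic set of type (SC) of $Q^+(5,q)$ is a set $X$ of points of $Q^+(5,q)$ such that every plane contained in $Q^+(5,q)$ meets $X$ either in a single point (type (S) plane) or in an oval of that plane (type (C) plane), and both types occur. An oval of a projective plane of order $q$ is a set of $q+1$ points no three collinear; for $q$ even, all its tangent lines pass through one point, its kernel (nucleus). *)

(* Defs.v *)
From HB Require Import structures.
From mathcomp Require Import all_boot all_order all_algebra.

Set Implicit Arguments.
Unset Strict Implicit.
Unset Printing Implicit Defensive.

Import GRing.Theory VectorInternalTheory.
Local Open Scope ring_scope.

(* The subtype structure of {vspace V} used here is only available inside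
   VectorInternalTheory. *)
HB.instance Definition _ (F : finFieldType) (V : vectType F) :=
  [Countable of {vspace V} by <:].
HB.instance Definition _ (F : finFieldType) (V : vectType F) :=
  [Finite of {vspace V} by <:].

(* The subspaces of PG(n-1, q) are the linear subspaces of F^n, q = #|F|; a
   point, line, plane or solid has linear dimension 1, 2, 3 or 4. *)
Record point (F : finFieldType) (n : nat) := Point {
  point_space :> {vspace 'rV[F]_n};
  dim_point : \dim point_space == 1%N }.

HB.instance Definition _ F n := [isSub for @point_space F n].
HB.instance Definition _ F n := [Finite of point F n by <:].

Section ProjectiveGeometry.
Variables (F : finFieldType) (n : nat).
Implicit Types (U L p : {vspace 'rV[F]_n}) (P N : point F n).
Implicit Types (X K O : {set point F n}).

Definition pts U : {set point F n} := [set P : point F n | (P <= U)%VS].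

Definition oval p K : bool :=
  [&& K \subset pts p, #|K| == #|F|.+1
    & [forall L : {vspace 'rV[F]_n}, (\dim L == 2%N) ==> (#|pts L :&: K| <= 2)%N]].

Definition tangent_line p K L : bool :=
  [&& \dim L == 2%N, (L <= p)%VS & #|pts L :&: K| == 1%N].

Definition oval_kernel p K N : bool :=
  (N \in pts p) &&
  [forall L : {vspace 'rV[F]_n}, tangent_line p K L ==> (N \in pts L)].

Section QuadraticForm.
Variable Q : 'rV[F]_n -> F.

Definition polar (u v : 'rV[F]_n) : F := Q (u + v) - Q u - Q v.

Definition quadratic_form : Prop :=
  (forall (a : F) (v : 'rV[F]_n), Q (a *: v) = a ^+ 2 * Q v) /\
  bilinear_for *%R *%R polar.

Definition totally_singular U : bool := [forall v in U, Q v == 0].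

Definition nonsingular_on U : bool :=
  [forall v in U, (Q v == 0) && [forall u in U, polar v u == 0] ==> (v == 0)].

Definition witt_index U : nat :=
  \max_(W : {vspace 'rV[F]_n} | (W <= U)%VS && totally_singular W) \dim W.

(* The form induced on U defines a quadric Q^+(2m-1, q), respectively
   Q^-(2m+1, q), where m is the (vector) Witt index. *)
Definition hyperbolic_on U : bool :=
  nonsingular_on U && (\dim U == (witt_index U).*2).
Definition elliptic_on U : bool :=
  nonsingular_on U && (\dim U == (witt_index U).+1.*2).

Definition quadric : {set point F n} :=
  [set P : point F n | totally_singular P].

(* The span only serves to package the set of all vectors orthogonal to U,
   which is already a subspace, as a {vspace _}; see memv_polarity. *)
Definition polarity U : {vspace 'rV[F]_n} :=
  <<[seq v <- enum 'rV[F]_n | [forall u in U, polar u v == 0]%R]>>%VS.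

Lemma memv_polarity U v : quadratic_form ->
  (v \in polarity U) = [forall u in U, polar u v == 0].
Proof.
move=> [_ [_ polar_lin]]; rewrite /polarity; set s := [seq _ <- _ | _].
apply/idP/idP => [v_s | orth_v]; last first.
  by rewrite memv_span // mem_filter orth_v mem_enum.
apply/forall_inP => u uU; apply/eqP.
have polar0 : polar u 0 = 0.
  by have := polar_lin u (-1) 0 0; rewrite scaler0 addr0 /= mulN1r addNr.
rewrite (coord_span (X := in_tuple s) v_s).
elim/big_ind: _ => [//|x y ux uy|i _].
  by rewrite -[x]scale1r polar_lin /= ux uy mulr0 addr0.
have : s`_i \in s by rewrite mem_nth.
rewrite mem_filter => /andP[/forall_inP/(_ u uU)/eqP us _].
by rewrite -[_ *: _]addr0 polar_lin /= us polar0 mulr0 addr0.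
Qed.

Definition quadric_plane p : bool := (\dim p == 3%N) && (pts p \subset quadric).

Definition type_S X p : bool := quadric_plane p && (#|pts p :&: X| == 1%N).

Definition type_C X p : bool := quadric_plane p && oval p (pts p :&: X).

Definition generalized_quadratic_SC X : Prop :=
  [/\ X \subset quadric,
      forall p, quadric_plane p -> type_S X p \/ type_C X p,
      exists p, type_S X p
    & exists p, type_C X p].

Definition A1 X : {set point F n} :=
  [set P in X | [exists p : {vspace 'rV[F]_n}, type_S X p && (P \in pts p)]].

Definition A2 X : {set point F n} :=
  [set N : point F n |
    [exists p : {vspace 'rV[F]_n}, type_C X p && oval_kernel p (pts p :&: X) N]].

Section Solid.
Variable Pi : {vspace 'rV[F]_n}.

Definition section_quadric : {set point F n} := pts Pi :&: quadric.

Definition W_line L : bool :=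
  [&& \dim L == 2%N, (L <= Pi)%VS & #|pts L :&: section_quadric| == 1%N].

Definition W_ovoid O : Prop :=
  O \subset pts Pi /\ forall L, W_line L -> #|pts L :&: O| = 1%N.

(* Definite description: such a plane exists and is unique for the points P of
   Pi off the quadric; elsewhere the default value 0 may be returned. *)
Definition W_plane P : {vspace 'rV[F]_n} :=
  odflt 0%VS [pick p : {vspace 'rV[F]_n} |
    [&& \dim p == 3%N, (p <= Pi)%VS
      & [forall L : {vspace 'rV[F]_n},
           W_line L && (P \in pts L) ==> (L <= p)%VS]]].

Definition conic_at P : {set point F n} :=
  pts (polarity (W_plane P)) :&: quadric.

Definition ovoid_set O : {set point F n} :=
  (\bigcup_(P in O :\: section_quadric) conic_at P)
    :|: (O :&: section_quadric).

End Solid.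
End QuadraticForm.
End ProjectiveGeometry.

(* Main.v *)
(* Write V = Pi + l with l := Pi^zeta; the line l is anisotropic, so the
   projection f : V -> Pi along l is injective on every plane p of the quadric.
   Such a p meets Pi in a single point x, and f maps p onto the tangent plane
   T_x = Pi & x^perp. Since (T_x)^perp = x + l, a point y of the quadric lies in
   X iff f(y) lies in O, so that p & X is projectively equivalent to T_x & O.

   Counting along pencils, |T_x & O| is 1 if x is in O, and q + 1 otherwise.
   Counting pairs (x, z) with x on a line L, z in O and z perpendicular to x
   gives |L & O| + |L^perp & O| = 2, so no line meets O in three points; and in
   T_x, x not in O, every tangent to T_x & O passes through x. Hence p has type
   (S) if x is in O, and type (C) with kernel x otherwise.

   Both types occur: O and Q^- have the same size q^2 + 1, so O <> Q^- yields a
   point of Q^- off O; and |O & Q^-| is odd. For the latter, the line counts say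
     sum_{z in O} (b(x,z) b(y,z))^(q-1) = b(x,y)^(q-1)     for all x, y in Pi.
   Polarizing one Frobenius factor of q - 1 = 1 + 2 + ... + q/2 at a time allows
   one to replace b(x,.)b(y,.) by any sum of such products, b(x,y) being replaced
   by the corresponding sum. For the form Q itself that sum is 1 + 1 = 0, whence
   sum_{z in O} Q(z)^(q-1) = 0, i.e. |O \ Q^-| is even. *)
From HB Require Import structures.
Require Import Defs.
From mathcomp Require Import all_boot all_order all_algebra all_field.
From mathcomp Require Import zify ring.
Set Implicit Arguments.
Unset Strict Implicit.
Unset Printing Implicit Defensive.

Import GRing.Theory.
Local Open Scope ring_scope.

Lemma double_count (S T : finType) (A : {set S}) (B : {set T})
    (r : S -> T -> bool) :
  (\sum_(a in A) #|[set b in B | r a b]| = \sum_(b in B) #|[set a in A | r a b]|)%N.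
Proof.
transitivity (\sum_(a in A) \sum_(b in B | r a b) 1)%N.
  by apply: eq_bigr => a _; rewrite sum1dep_card; apply: eq_card => b; rewrite !inE.
rewrite (exchange_big_dep (mem B)) /=; last by move=> ? ? _ /andP[].
apply: eq_bigr => b bB; rewrite sum1dep_card; apply: eq_card => a.
by rewrite !inE bB.
Qed.

(** * Points of a projective space *)

Section Points.
Variables (F : finFieldType) (n : nat).
Implicit Types (P R N : point F n) (U W L : {vspace 'rV[F]_n}) (v : 'rV[F]_n).

Definition rep P : 'rV[F]_n := vpick P.

Lemma dim_pt P : \dim P = 1%N.
Proof. exact/eqP/dim_point. Qed.

Lemma rep_neq0 P : rep P != 0.
Proof. by rewrite vpick0 -dimv_eq0 dim_pt. Qed.

Lemma point_span P : P = <[rep P]>%VS :> {vspace _}.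
Proof.
apply/esym/eqP; rewrite eqEdim -memvE memv_pick dim_pt.
by rewrite dim_vline rep_neq0.
Qed.

Lemma mem_pts P U : (P \in pts U) = (rep P \in U).
Proof. by rewrite inE {1}point_span memvE. Qed.

Lemma mem_ptP P v : reflect (exists k, v = k *: rep P) (v \in (P : {vspace _})).
Proof. by rewrite {1}point_span; apply: vlineP. Qed.

Lemma mem_rep P : rep P \in (P : {vspace _}).
Proof. exact: memv_pick. Qed.

Lemma point_of v : v != 0 -> exists P, P = <[v]>%VS :> {vspace _}.
Proof.
move=> vn0; have dv : \dim <[v]> == 1%N by rewrite dim_vline vn0.
by exists (Point dv).
Qed.

Lemma pt_subE P R : (P <= R)%VS = (P == R).
Proof.
by rewrite -(inj_eq val_inj) /= eqEdim !dim_pt leqnn andbT.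
Qed.

Lemma pts_pt P : pts P = [set P].
Proof. by apply/setP=> R; rewrite !inE pt_subE. Qed.

Lemma ptsS U W : (U <= W)%VS -> pts U \subset pts W.
Proof. by move=> sUW; apply/subsetP => P; rewrite !inE => /subv_trans; apply. Qed.

Lemma pts_cap U W : pts (U :&: W) = pts U :&: pts W.
Proof. by apply/setP=> P; rewrite !inE subv_cap. Qed.

Lemma pts_subP U W : reflect (U <= W)%VS (pts U \subset pts W).
Proof.
apply: (iffP idP) => [/subsetP sUW|]; last exact: ptsS.
apply/subvP => v vU; have [->|vn0] := eqVneq v 0; first exact: mem0v.
have [P eP] := point_of vn0.
by have := sUW P; rewrite !inE eP -!memvE; apply.
Qed.

Lemma dim1_pt U : \dim U = 1%N -> exists P, P = U :> {vspace _}.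
Proof. by move=> /eqP dU; exists (Point dU). Qed.

Lemma card_pts_dim1 U : \dim U = 1%N -> #|pts U| = 1%N.
Proof. by move=> /dim1_pt[P <-]; rewrite pts_pt cards1. Qed.

Lemma card_nonzero U : #|[set v in U | v != 0]| = (#|F| ^ \dim U).-1.
Proof.
rewrite -card_vspace [in RHS](cardD1 (0 : 'rV[F]_n)) (mem0v U) /=.
by apply: eq_card => v; rewrite !inE andbC.
Qed.

(** Double counting of pairs of a point of [U] and a nonzero vector on it: each point carries q - 1
    such vectors, each nonzero vector of [U] spans one point. *)
Lemma card_pts U : (#|pts U| * #|F|.-1 = (#|F| ^ \dim U).-1)%N.
Proof.
have := double_count (pts U) [set v in U | v != 0]
  (fun (P : point F n) (v : 'rV[F]_n) => v \in (P : {vspace _})).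
rewrite (eq_bigr (fun=> #|F|.-1)) => [|P].
  rewrite sum_nat_const => ->; rewrite (eq_bigr (fun=> 1%N)) => [|v].
    by rewrite sum_nat_const muln1 card_nonzero.
  rewrite inE => /andP[vU vn0]; have [P eP] := point_of vn0.
  apply/eqP/cards1P; exists P; apply/setP=> R; rewrite !inE.
  apply/andP/eqP => [[_ vR]|->]; last by rewrite eP -!memvE vU memv_line.
  by apply/esym/eqP; rewrite -pt_subE eP -memvE.
rewrite inE => PU; have := card_nonzero P; rewrite dim_pt expn1 => <-.
apply: eq_card => v; rewrite !inE -andbA [in RHS]andbC.
have [vP|_] := boolP (v \in (P : {vspace _})); last by rewrite !andbF.
by rewrite (subvP PU _ vP) andbT.
Qed.

Lemma card_pts_line L : \dim L = 2%N -> #|pts L| = #|F|.+1.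
Proof.
move=> dL; have := card_pts L; rewrite dL.
have := finNzRing_gt1 F; move: #|pts L| #|F| => m q q1 e.
by apply/eqP; rewrite -(eqn_pmul2r (_ : 0 < q.-1)%N) ?e -?mulnn; [apply/eqP|]; nia.
Qed.

Lemma notin_cap P U : P \notin pts U -> (P :&: U = 0)%VS.
Proof.
move=> PU; apply/eqP; rewrite -dimv_eq0; apply: contraR PU => /eqP d0.
have : (P :&: U <= P)%VS by exact: capvSl.
move=> /dimv_leqif_eq/geq_leqif; rewrite dim_pt lt0n; move/eqP in d0.
rewrite d0 => /esym/eqP e; rewrite inE -e capvSr //.
Qed.

Lemma dim_addpt P U : P \notin pts U -> \dim (P + U) = (\dim U).+1.
Proof. by move=> /notin_cap e; rewrite dimv_disjoint_sum // dim_pt. Qed.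

Lemma dim_join P R : P != R -> \dim (P + R) = 2%N.
Proof. by move=> PR; rewrite dim_addpt ?dim_pt // pts_pt inE. Qed.

(** The lines joining [x] to the points of [M] partition the points of [x + M] other than [x]: such
    a point [z] lies only on the line through [m], the intersection of [M] with the line [z + x]. *)
Lemma pencil_count x M (S : {set point F n}) : x \notin pts M ->
  #|(pts (x + M) :&: S) :\ x|
  = (\sum_(m in pts M) #|(pts (x + m) :&: S) :\ x|)%N.
Proof.
move=> xM; rewrite -[LHS]muln1 -sum_nat_const.
rewrite [RHS](eq_bigr (fun m : point F n => #|[set z in (pts (x + M) :&: S) :\ x | z \in pts (x + m)]|)); last first.
  move=> m; rewrite inE => mM; apply: eq_card => z; rewrite !inE.
  case: (z != x) => //=; case: (z \in S); rewrite ?andbF ?andbT //=.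
  by case E: (z <= x + m)%VS; rewrite ?andbF // andbT (subv_trans E) // addvS.
rewrite double_count; apply: eq_bigr => z; rewrite !inE => /andP[zx /andP[zxM _]].
have dxz := dim_join zx.
have e : [set m in pts M | z \in pts (x + m)] = pts (M :&: (z + x)).
  apply/setP=> m; rewrite !inE subv_cap; case mM: (m <= M)%VS => //=.
  have mx : m != x by apply: contraNneq xM => <-; rewrite inE.
  have dxm := dim_join mx.
  apply/idP/idP => h.
    have : (z + x <= m + x)%VS by rewrite subv_add addvSr addvC h.
    by move=> /dimv_leqif_eq/geq_leqif; rewrite dxz dxm leqnn => /esym/eqP ->; rewrite addvSl.
  have : (m + x <= z + x)%VS by rewrite subv_add addvSr h.
  by move=> /dimv_leqif_eq/geq_leqif; rewrite dxz dxm leqnn addvC => /esym/eqP ->; rewrite addvSl.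
rewrite e card_pts_dim1 //.
have := dimv_sum_cap M (z + x).
rewrite (_ : (M + (z + x))%VS = (x + M)%VS).
  by rewrite dxz dim_addpt //; lia.
apply/eqP; rewrite eqEsubv !subv_add zxM addvSl addvSr /=.
by rewrite (subv_trans (addvSr z x)) ?addvSr ?addvSl.
Qed.

End Points.

(** * Quadratic forms in characteristic 2 *)

Section EvenField.
Variables (F : finFieldType) (q_even : ~~ odd #|F|).

Lemma card_even : exists t, #|F| = (2 ^ t.+1)%N /\ 2%N \in [pchar F].
Proof.
have [p p_pr charp] := finPcharP F.
have [m cF] : exists m, #|F| = (p ^ m)%N.
  by exists (logn p #|F|); apply: (card_pprimeChar charp).
have : ~~ odd (p ^ m) by rewrite -cF.
rewrite oddX negb_or => /andP[m0 pe].
have p2 : p = 2%N by case/even_prime: p_pr pe => // ->.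
case: m m0 cF => // m _ cF; exists m; by rewrite cF -p2.
Qed.

Lemma pchar2 : 2%N \in [pchar F].
Proof. by have [t []] := card_even. Qed.

Lemma addrr_even (a : F) : a + a = 0.
Proof. by rewrite (addrr_pchar2 pchar2). Qed.

Lemma oppr_even (a : F) : - a = a.
Proof. by rewrite (oppr_pchar2 pchar2). Qed.

Lemma sqrt_exists (a : F) : exists c, c ^+ 2 = a.
Proof.
(* As q is even, the square of this power is a^q = a. *)
exists (a ^+ #|F|./2); rewrite -exprM muln2 -[RHS]expf_card.
by rewrite -[#|F| in RHS]odd_double_half (negbTE q_even).
Qed.

End EvenField.

Section Form.
Variables (F : finFieldType) (n : nat) (q_even : ~~ odd #|F|).
Variables (Q : 'rV[F]_n -> F) (quadQ : quadratic_form Q).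
Local Notation b := (polar Q).
Implicit Types (P R N x : point F n) (U W L : {vspace 'rV[F]_n}).
Implicit Types u v w : 'rV[F]_n.

Lemma polarC u v : b u v = b v u.
Proof. by rewrite /polar [u + v]addrC addrAC. Qed.

Lemma polarPr a u v w : b u (a *: v + w) = a * b u v + b u w.
Proof. by have [_ [_ ->]] := quadQ. Qed.

Lemma polar0r u : b u 0 = 0.
Proof. by have := polarPr (-1) u 0 0; rewrite scaler0 addr0 mulN1r addNr. Qed.

Lemma polarDr u v w : b u (v + w) = b u v + b u w.
Proof. by have := polarPr 1 u v w; rewrite scale1r mul1r. Qed.

Lemma polarZr a u v : b u (a *: v) = a * b u v.
Proof. by have := polarPr a u v 0; rewrite polar0r !addr0. Qed.

Lemma polarDl u v w : b (v + w) u = b v u + b w u.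
Proof. by rewrite !(polarC _ u) polarDr. Qed.

Lemma polarZl a u v : b (a *: v) u = a * b v u.
Proof. by rewrite !(polarC _ u) polarZr. Qed.

Lemma polar0l u : b 0 u = 0.
Proof. by rewrite polarC polar0r. Qed.

Lemma quadZ a v : Q (a *: v) = a ^+ 2 * Q v.
Proof. by have [->] := quadQ. Qed.

Lemma quad0 : Q 0 = 0.
Proof. by have := quadZ 0 0; rewrite scaler0 expr2 !mul0r. Qed.

Lemma quadD u v : Q (u + v) = Q u + Q v + b u v.
Proof. by rewrite /polar -[_ - _ - _]addrA -opprD [RHS]addrC subrK. Qed.

Lemma polarvv v : b v v = 0.
Proof.
rewrite /polar -{1 2}[v]scale1r -scalerDl (addrr_even q_even) scale0r quad0 sub0r.
exact: addrr_even q_even _.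
Qed.

Lemma quad_isotropic (c : F) u v : b u v = 0 -> Q (u + c *: v) = Q u + c ^+ 2 * Q v.
Proof. by move=> buv; rewrite quadD polarZr buv mulr0 addr0 quadZ. Qed.

Lemma memv_orth U v : v \in polarity Q U <-> (forall u, u \in U -> b u v = 0).
Proof.
rewrite memv_polarity //; split => [/forall_inP h u /h /eqP //|h].
by apply/forall_inP => u /h ->.
Qed.

Lemma orth_line u v : (v \in polarity Q <[u]>) = (b u v == 0).
Proof.
apply/idP/eqP => [/memv_orth -> //|buv]; first exact: memv_line.
by apply/memv_orth => w /vlineP[k ->]; rewrite polarZl buv mulr0.
Qed.

Lemma orth_pt P v : (v \in polarity Q P) = (b (rep P) v == 0).
Proof. by rewrite point_span orth_line. Qed.

Lemma orthC U W : (U <= polarity Q W)%VS -> (W <= polarity Q U)%VS.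
Proof.
move=> /subvP h; apply/subvP => w wW; apply/memv_orth => u uU.
by rewrite polarC; move/memv_orth: (h u uU); apply.
Qed.

Lemma orthS U W : (U <= W)%VS -> (polarity Q W <= polarity Q U)%VS.
Proof.
move=> /subvP sUW; apply/subvP=> v /memv_orth h; apply/memv_orth => u /sUW; exact: h.
Qed.

Lemma orthD U W : polarity Q (U + W) = (polarity Q U :&: polarity Q W)%VS.
Proof.
apply/vspaceP => v; rewrite memv_cap; apply/idP/andP => [/memv_orth h|[/memv_orth hU /memv_orth hW]].
  split; apply/memv_orth => u uU; apply: h; first exact: subvP (addvSl _ _) _ uU.
  exact: subvP (addvSr _ _) _ uU.
by apply/memv_orth => _ /memv_addP[u uU [w wW ->]]; rewrite polarDl hU // hW // addr0.
Qed.

(** Rank-nullity on [U] for the map [v] to the values of b against a basis of [W]: the kernel is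
    orthogonal to [W] and the rank is at most [\dim W]. It is only an inequality, since these linear
    forms may be dependent on [U]. *)
Lemma dim_cap_orth U W : (\dim U <= \dim (U :&: polarity Q W) + \dim W)%N.
Proof.
pose f (v : 'rV[F]_n) : 'rV[F]_(\dim W) := \row_i b (vbasis W)`_i v.
have f_lin : linear f.
  by move=> a u v; apply/rowP => i; rewrite !mxE polarPr.
pose fL := GRing.isLinear.Build _ _ _ _ f f_lin.
pose g := linfun (HB.pack_for {linear 'rV[F]_n -> 'rV[F]_(\dim W)} f fL).
rewrite -(limg_ker_dim g U); apply: leq_add.
  apply: dimvS; apply: capvS => //; apply/subvP => v.
  rewrite memv_ker lfunE /= => /eqP/rowP fv0; apply/memv_orth => w wW.
  rewrite (coord_vbasis wW) polarC.
  have -> : b v (\sum_(i < \dim W) coord (vbasis W) i w *: (vbasis W)`_i)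
     = \sum_(i < \dim W) coord (vbasis W) i w * b v (vbasis W)`_i.
    elim/big_rec2: _ => [|i y1 y2 _ e]; first exact: polar0r.
    by rewrite polarPr e.
  apply: big1 => i _; have := fv0 i; rewrite !mxE polarC => ->.
  by rewrite mulr0.
by apply: leq_trans (dimvS (subvf _)) _; rewrite dimvf /dim /= mul1n.
Qed.

Lemma quad_scalar_eq0 v w : v != 0 -> v \in <[w]>%VS -> (Q v == 0) = (Q w == 0).
Proof.
move=> v0 /vlineP[k e]; rewrite e quadZ mulf_eq0 sqrf_eq0; case: eqP => // k0.
by rewrite e k0 scale0r eqxx in v0.
Qed.

Lemma totally_singularP U :
  reflect (forall v, v \in U -> Q v = 0) (totally_singular Q U).
Proof. by apply: (iffP forall_inP) => h v /h /eqP. Qed.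

Lemma singular_orth U : totally_singular Q U ->
  forall u v, u \in U -> v \in U -> b u v = 0.
Proof.
move=> /totally_singularP h u v uU vU.
by rewrite /polar !h ?subr0 // memvD.
Qed.

Lemma mem_quadric P : (P \in quadric Q) = (Q (rep P) == 0).
Proof.
rewrite inE; apply/totally_singularP/eqP => [-> //|h]; first exact: mem_rep.
by move=> v; rewrite {1}point_span => /vlineP[k ->]; rewrite quadZ h mulr0.
Qed.

Lemma singular_pts U : (pts U \subset quadric Q) = totally_singular Q U.
Proof.
apply/subsetP/totally_singularP => [h v vU|h P]; last first.
  by rewrite mem_pts mem_quadric => /h ->.
have [->|v0] := eqVneq v 0; first exact: quad0.
have [P eP] := point_of v0.
have := h P; rewrite mem_quadric inE eP -memvE => /(_ vU) e.
by apply/eqP; rewrite -(quad_scalar_eq0 (rep_neq0 P)) // -eP mem_rep.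
Qed.

Lemma witt_attained U : exists W, [/\ (W <= U)%VS, totally_singular Q W & \dim W = witt_index Q U].
Proof.
have [|W /andP[WU sW] e] := @eq_bigmax_cond _
    [pred W : {vspace 'rV[F]_n} | (W <= U)%VS && totally_singular Q W] (fun W => \dim W).
  apply/card_gt0P; exists 0%VS; rewrite inE sub0v /=; apply/totally_singularP => v.
  by rewrite memv0 => /eqP ->; exact: quad0.
by exists W; split => //; rewrite -e.
Qed.

Lemma leq_witt U W : (W <= U)%VS -> totally_singular Q W -> (\dim W <= witt_index Q U)%N.
Proof.
move=> WU sW; apply: (@leq_bigmax_cond _ (fun W : {vspace 'rV[F]_n} =>
  (W <= U)%VS && totally_singular Q W) (fun W => \dim W) W); by rewrite WU.
Qed.

End Form.

(** * Power sums *)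

Section PolynomialIdentities.
Variables (F : finFieldType) (q_even : ~~ odd #|F|).

Lemma mulrn_odd (a : F) m : a *+ m = a *+ odd m.
Proof.
rewrite -[m in LHS]odd_double_half mulrnDr -muln2 mulrnA mulr2n.
by rewrite (addrr_even q_even) addr0.
Qed.

Lemma expf_pred_card (a : F) : a ^+ #|F|.-1 = (a != 0)%:R.
Proof.
have q1 := finNzRing_gt1 F; have [->|a0] := eqVneq a 0.
  by rewrite expr0n; case: #|F| q1 => [|[]].
by apply: (mulfI a0); rewrite -exprS prednK ?expf_card ?mulr1 // ltnW.
Qed.

(** Otherwise the nonzero difference, of degree less than q, would have all q field elements as
    roots. *)
Lemma poly_ext_card (p r : {poly F}) : (size p <= #|F|)%N -> (size r <= #|F|)%N ->
  (forall c, p.[c] = r.[c]) -> p = r.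
Proof.
move=> sp sr e; apply/eqP; rewrite -subr_eq0; apply/negPn/negP => pr0.
have := max_poly_roots pr0 (rs := enum F).
have -> : all (root (p - r)) (enum F).
  by apply/allP => c _; rewrite /root !hornerE e subrr.
rewrite enum_uniq -cardT => /(_ isT isT); apply/negP; rewrite -leqNgt.
by rewrite (leq_trans (size_polyD _ _)) // size_polyN geq_max sp.
Qed.

(** The power is kept as a formal polynomial in the perturbation parameter, so that coefficients can
    be compared. *)
Definition linpow (a d : F) m : {poly F} := (a%:P + d *: 'X) ^+ m.

Lemma horner_linpow a d m c : (linpow a d m).[c] = (a + c * d) ^+ m.
Proof. by rewrite horner_exp !hornerE mulrC. Qed.

Lemma size_linpow a d m : (size (linpow a d m) <= m.+1)%N.
Proof.
apply: leq_trans (size_poly_exp_leq _ _) _; rewrite ltnS -[leqRHS]mul1n leq_mul2r.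
apply/orP; right; rewrite -subn1 leq_subLR (leq_trans (size_polyD _ _)) // geq_max.
rewrite (leq_trans (size_polyC_leq1 _)) // (leq_trans (size_scale_leq _ _)) //.
by rewrite size_polyX.
Qed.

Lemma deriv_linpow a d m : (linpow a d m)^`().[0] = a ^+ m.-1 * d *+ m.
Proof.
rewrite /linpow deriv_exp derivD derivC derivZ derivX add0r.
by rewrite hornerMn !hornerE mulrC.
Qed.

(** Both sides have degree less than q and agree at every [c], hence are equal as polynomials. The
    linear coefficient of the power is m a^(m-1) d, and m = 1 in characteristic 2 because m is
    odd. *)
Lemma linear_coef (T : finType) (A : {set T}) (w a d : T -> F) m (r : {poly F}) :
  odd m -> (m < #|F|)%N -> (size r <= #|F|)%N ->
  (forall c, \sum_(z in A) w z * (a z + c * d z) ^+ m = r.[c]) ->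
  \sum_(z in A) w z * (a z ^+ m.-1 * d z) = r^`().[0].
Proof.
move=> om mq sr e.
have <- : \sum_(z in A) w z *: linpow (a z) (d z) m = r.
  apply: poly_ext_card => // [|c].
    apply: leq_trans (size_sum _ _ _) _; apply/bigmax_leqP => z _.
    by rewrite (leq_trans (size_scale_leq _ _)) // (leq_trans (size_linpow _ _ _)).
  rewrite -e horner_sum; apply: eq_bigr => z _.
  by rewrite hornerZ horner_linpow.
rewrite raddf_sum horner_sum; apply: eq_bigr => z _.
by rewrite /= derivZ hornerZ deriv_linpow mulrn_odd om.
Qed.

End PolynomialIdentities.

(** * From power sums of the polar form to power sums of the quadratic form *)

Section PowerSums.
Variables (F : finFieldType) (n : nat) (q_even : ~~ odd #|F|).
Variables (Q : 'rV[F]_n -> F) (quadQ : quadratic_form Q).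
Local Notation b := (polar Q).
Local Notation q := #|F|.
Variables (Pi : {vspace 'rV[F]_n}) (S : {set point F n}).
Implicit Types u v w x y : 'rV[F]_n.
Hypothesis SPi : S \subset pts Pi.
Hypothesis power_sum : forall x y, x \in Pi -> y \in Pi ->
  \sum_(z in S) (b x (rep z) * b y (rep z)) ^+ q.-1 = b x y ^+ q.-1.
Variables (r : seq ('rV[F]_n * 'rV[F]_n)).
Hypothesis rPi : forall p, p \in r -> p.1 \in Pi /\ p.2 \in Pi.
Hypothesis Q_decomp : forall z, z \in Pi -> Q z = \sum_(p <- r) b p.1 z * b p.2 z.

(* Replacing [x] by [x + a x'], both sides become polynomials in [a] of degree
   less than [q]; compare their linear coefficients, then do the same for [y]. *)
Lemma power_sum_polarized j (c : 'rV[F]_n -> F) (e : F) : (2 ^ j.+1 <= q)%N ->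
  (forall x y, x \in Pi -> y \in Pi ->
    \sum_(z in S) c (rep z) * (b x (rep z) * b y (rep z)) ^+ (2 ^ j.+1).-1
      = e * b x y ^+ (2 ^ j.+1).-1) ->
  forall x y x' y', x \in Pi -> y \in Pi -> x' \in Pi -> y' \in Pi ->
    \sum_(z in S) c (rep z) * ((b x (rep z) * b y (rep z)) ^+ (2 ^ j.+1).-2
        * (b x' (rep z) * b y' (rep z)))
      = e * (b x y ^+ (2 ^ j.+1).-2 * b x' y').
Proof.
set m := (2 ^ j.+1).-1; move=> jq sum_xy.
have m1 : (2 ^ j.+1 = m.+1)%N by rewrite prednK // expn_gt0.
have mq : (m < q)%N by rewrite -m1.
have om : odd m by have := oddX 2 j.+1; rewrite m1 /= => /negbFE.
have m0 : (0 < m)%N by rewrite lt0n; apply: contraTneq om => ->.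
(* First polarization: the linear coefficient in the perturbation of [x] by [x']. *)
have step1 x x' y : x \in Pi -> x' \in Pi -> y \in Pi ->
  \sum_(z in S) c (rep z) * ((b x (rep z) * b y (rep z)) ^+ m.-1
      * (b x' (rep z) * b y (rep z))) = e * (b x y ^+ m.-1 * b x' y).
  move=> xPi x'Pi yPi.
  have := @linear_coef F q_even _ S (fun z => c (rep z)) (fun z => b x (rep z) * b y (rep z))
    (fun z => b x' (rep z) * b y (rep z)) m (e *: linpow (b x y) (b x' y) m) om mq.
  rewrite derivZ hornerZ deriv_linpow mulrn_odd // om; apply.
    by rewrite (leq_trans (size_scale_leq _ _)) // (leq_trans (size_linpow _ _ _)).
  move=> a; rewrite hornerZ horner_linpow -(polarZl quadQ) -(polarDl quadQ) -sum_xy //; last first.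
    by rewrite memvD // memvZ.
  apply: eq_bigr => z _; congr (_ * _ ^+ _).
  by rewrite (polarDl quadQ) (polarZl quadQ); ring.
move=> x y x' y' xPi yPi x'Pi y'Pi.
(* The right side of [step1] with [y] perturbed by [y']. On the left, the factors depending on [x]
   and [x'] are absorbed into the weights. *)
pose rr := e *: (linpow (b x y) (b x y') m.-1 * linpow (b x' y) (b x' y') 1).
have := @linear_coef F q_even _ S (fun z => c (rep z) * (b x (rep z) ^+ m.-1 * b x' (rep z)))
  (fun z => b y (rep z)) (fun z => b y' (rep z)) m rr om mq.
have -> : rr^`().[0] = e * (b x y ^+ m.-1 * b x' y').
  rewrite derivZ hornerZ derivM hornerD !hornerM !deriv_linpow horner_linpow.
  rewrite [_ *+ m.-1]mulrn_odd // [_ *+ 1]mulrn_odd //.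
  (* As m - 1 is even, the first factor has zero derivative in characteristic 2, so only the term
     with [b x' y'] survives. *)
  have -> : odd m.-1 = false by case: (m) m0 om => //= ? _ /negbTE.
  by rewrite horner_linpow mulr0n mul0r add0r !mul0r !addr0 mul1r.
move=> h; rewrite -h.
- by apply: eq_bigr => z _; rewrite exprMn; ring.
- rewrite (leq_trans (size_scale_leq _ _)) // (leq_trans (size_polyMleq _ _)) //.
  have := size_linpow (b x y) (b x y') m.-1; have := size_linpow (b x' y) (b x' y') 1.
  rewrite prednK //; lia.
move=> a; rewrite hornerZ hornerM !horner_linpow -!(polarZr quadQ) -!(polarDr quadQ).
rewrite expr1 -step1 ?memvD ?memvZ //; apply: eq_bigr => z _.
rewrite (polarDl quadQ) (polarZl quadQ); set B := b y _ + _.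
have -> : B ^+ m = B ^+ m.-1 * B by rewrite -exprSr prednK.
by rewrite exprMn; ring.
Qed.

(* The next identity follows, after squaring, by summing the polarized one over
   the terms of the decomposition of [Q]; note that [Q z ^+ q = Q z]. *)
Lemma power_sum_descent t j : q = (2 ^ t)%N -> (j <= t)%N ->
  forall x y, x \in Pi -> y \in Pi ->
  \sum_(z in S) Q (rep z) ^+ (q - 2 ^ (t - j))
     * (b x (rep z) * b y (rep z)) ^+ (2 ^ (t - j)).-1
  = (\sum_(p <- r) b p.1 p.2) ^+ (q - 2 ^ (t - j)) * b x y ^+ (2 ^ (t - j)).-1.
Proof.
move=> qt; elim: j => [_ x y xPi yPi|j IHj jt x y xPi yPi].
  rewrite subn0 -qt subnn !expr0 mul1r -power_sum //.
  by apply: eq_bigr => z _; rewrite mul1r.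
move: IHj => /(_ (ltnW jt)); set i := (t - j.+1)%N.
have -> : (t - j = i.+1)%N by rewrite subnSK.
set beta := \sum_(p <- r) _ => IHj.
have iq : (2 ^ i.+1 <= q)%N by rewrite qt leq_pexp2l // /i; lia.
have h x' y' := power_sum_polarized iq (c := fun v => Q v ^+ (q - 2 ^ i.+1)) IHj xPi yPi (x' := x') (y' := y').
have ei : (2 ^ i.+1).-2 = ((2 ^ i).-1 * 2)%N.
  by rewrite expnS; have := expn_gt0 2 i; case: (2 ^ i)%N => // k _; lia.
(* The square has exponent 2q - 2^(i+1), and a^q = a lowers it by q - 1. *)
have eq2 (a : F) : (a ^+ (q - 2 ^ i)) ^+ 2 = a ^+ (q - 2 ^ i.+1) * a.
  rewrite -exprM -{3}(expf_card a) -exprD; congr (_ ^+ _).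
  by move: iq; rewrite expnS; lia.
(* Squaring is additive and injective in characteristic 2, so it suffices to prove the squared
   identity, whose exponents are those of the polarized one. *)
apply/eqP; rewrite -subr_eq0 -sqrf_eq0; apply/eqP.
have -> : forall a d : F, (a - d) ^+ 2 = a ^+ 2 - d ^+ 2.
  by move=> a d; rewrite sqrrB mulr2n (addrr_even q_even) subr0 -[in RHS](oppr_even q_even (d ^+ 2)) opprK.
have -> : forall f : point F n -> F, (\sum_(z in S) f z) ^+ 2 = \sum_(z in S) f z ^+ 2.
  move=> f; apply: (big_morph (fun a : F => a ^+ 2)) => [a d|]; last by rewrite expr0n.
  by rewrite sqrrD mulr2n (addrr_even q_even) addr0.
apply/eqP; rewrite subr_eq0; apply/eqP.
rewrite exprMn eq2 -exprM -ei.
(* The single extra factor Q(z) produced by [eq2] is expanded by [Q_decomp]. *)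
transitivity (\sum_(p <- r) \sum_(z in S) Q (rep z) ^+ (q - 2 ^ i.+1) *
   ((b x (rep z) * b y (rep z)) ^+ (2 ^ i.+1).-2 * (b p.1 (rep z) * b p.2 (rep z)))).
  rewrite exchange_big; apply: eq_bigr => z zS /=.
  rewrite exprMn eq2 -exprM -ei -!mulr_sumr -Q_decomp; first by ring.
  by rewrite -mem_pts (subsetP SPi).
rewrite (eq_big_seq (fun p => beta ^+ (q - 2 ^ i.+1) * (b x y ^+ (2 ^ i.+1).-2 * b p.1 p.2))).
  by rewrite -!mulr_sumr -/beta; ring.
by move=> p /rPi[p1 p2]; exact: h.
Qed.

End PowerSums.

(** * The elliptic quadric and the ovoids of W(q) *)

Section EllipticSolid.
Variables (F : finFieldType) (n : nat) (q_even : ~~ odd #|F|).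
Variables (Q : 'rV[F]_n -> F) (quadQ : quadratic_form Q).
Variables (Pi : {vspace 'rV[F]_n}) (dimPi : \dim Pi = 4%N).
Hypothesis ellPi : elliptic_on Q Pi.
Local Notation b := (polar Q).
Local Notation q := #|F|.
Local Notation tangent_plane x := (Pi :&: polarity Q x)%VS.
Implicit Types (P R N x y z : point F n) (U W L M : {vspace 'rV[F]_n}).
Implicit Types u v w : 'rV[F]_n.

(** * Duality in the elliptic solid *)

Lemma dim_singular_le1 U : (U <= Pi)%VS -> totally_singular Q U -> (\dim U <= 1)%N.
Proof.
move=> UPi sU; have := leq_witt UPi sU; have /andP[_] := ellPi; rewrite dimPi.
by case: witt_index => [|[|]].
Qed.

Lemma singular_line u v : u \in Pi -> v \in Pi -> Q u = 0 -> Q v = 0 ->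
  b u v = 0 -> u != 0 -> v \in <[u]>%VS.
Proof.
move=> uPi vPi Qu Qv buv u0.
have sU : totally_singular Q (<[u]> + <[v]>).
  apply/totally_singularP => _ /memv_addP[_ /vlineP[k ->] [_ /vlineP[l ->] ->]].
  by rewrite quadD !(quadZ quadQ) // (polarZl quadQ) // (polarZr quadQ) // Qu Qv buv !mulr0 !addr0.
have UPi : (<[u]> + <[v]> <= Pi)%VS by rewrite subv_add -!memvE uPi.
have /dimv_leqif_eq/geq_leqif := addvSl <[u]> <[v]>.
by rewrite dim_vline u0 dim_singular_le1 // => /esym/eqP ->; rewrite memvE addvSr.
Qed.

Lemma dim_cap_line U v : (\dim U <= (\dim (U :&: polarity Q <[v]>)).+1)%N.
Proof.
apply: leq_trans (dim_cap_orth quadQ U <[v]>) _.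
by rewrite -[leqRHS]addn1 leq_add2l dim_vline leq_b1.
Qed.

(** [nonsingular_on] excludes only singular radical vectors, so a nonzero radical [v] has Q(v)
    nonzero. Take a singular [s] and a vector [w] orthogonal to [s] outside the span of [s] and [v];
    adding a multiple of [v] makes [w] singular while keeping it orthogonal to [s], against
    [singular_line]. *)
Lemma polar_nondegenerate v : v \in Pi -> (forall u, u \in Pi -> b v u = 0) -> v = 0.
Proof.
move=> vPi vrad; apply/eqP; apply/negP => /negP v0.
have Qv : Q v != 0.
  have /andP[/forall_inP/(_ v vPi) + _] := ellPi; rewrite (negbTE v0) implybF.
  rewrite negb_and => /orP[//|/negP[]]; apply/forall_inP => u uPi; exact/eqP/vrad.
have [W [WPi sW dW]] := witt_attained quadQ Pi.
have dW1 : \dim W = 1%N.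
  by rewrite dW; have /andP[_] := ellPi; rewrite dimPi; case: witt_index => [|[|]].
pose s := vpick W; have s0 : s != 0 by rewrite vpick0 -dimv_eq0 dW1.
have sPi : s \in Pi by apply: (subvP WPi); apply: memv_pick.
have Qs : Q s = 0 by move/totally_singularP: sW; apply; apply: memv_pick.
have /subvPn[w] : ~~ (Pi :&: polarity Q <[s]> <= <[s]> + <[v]>)%VS.
  apply/negP => /dimvS h; have := dim_cap_line Pi s; rewrite dimPi.
  rewrite ltnNge ltnS (leq_trans h) //.
  by apply: leq_trans (dimv_add_leqif _ _) _; rewrite !dim_vline s0 v0.
rewrite memv_cap (orth_line quadQ) // => /andP[wPi /eqP bsw] /negP[].
(* With this [c], Q(w + c v) = Q(w) + c^2 Q(v) = 2 Q(w) = 0. *)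
have [c e] := sqrt_exists q_even (Q w / Q v).
have h : w + c *: v \in <[s]>%VS.
  apply: singular_line => //; first by rewrite memvD // memvZ.
    rewrite (quad_isotropic quadQ) //; last by rewrite polarC vrad.
    by rewrite e divfK // (addrr_even q_even).
  by rewrite (polarDr quadQ) // (polarZr quadQ) // bsw polarC vrad // mulr0 addr0.
rewrite -[w](addrK (c *: v)); apply: memv_add => //.
by rewrite memvN memvZ // memv_line.
Qed.

Lemma cap_orth_solid : (Pi :&: polarity Q Pi = 0)%VS.
Proof.
apply/eqP; rewrite -subv0; apply/subvP => v.
rewrite memv_cap => /andP[vPi /(memv_orth quadQ) h]; rewrite memv0.
by apply/eqP/polar_nondegenerate => // u uPi; rewrite polarC h.
Qed.

(** One inequality is [dim_cap_orth] for [Pi] and [U]. For the other, let [W] complement [U'] in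
    [Pi]: a vector of [U] orthogonal to [W] is also orthogonal to [U'], hence to [Pi], hence zero;
    so [\dim U <= \dim W]. *)
Lemma dim_solid_orth U : (U <= Pi)%VS -> (\dim (Pi :&: polarity Q U) + \dim U = 4)%N.
Proof.
move=> UPi; set U' := (Pi :&: _)%VS.
have h1 := dim_cap_orth quadQ Pi U; rewrite dimPi -/U' in h1.
pose W := (Pi :\: U')%VS.
have dW : (\dim U' + \dim W = 4)%N.
  have := dimv_cap_compl Pi U'; rewrite dimPi -/W => <-; congr (\dim _ + _)%N.
  by apply/esym/capv_idPr; rewrite capvSl.
have h2 := dim_cap_orth quadQ U W.
suff e : (U :&: polarity Q W = 0)%VS by rewrite e dimv0 in h2; lia.
apply/eqP; rewrite -subv0; apply/subvP => u.
rewrite memv_cap => /andP[uU /(memv_orth quadQ) h]; rewrite memv0.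
apply/eqP/polar_nondegenerate; first exact: subvP UPi _ uU.
move=> v; rewrite -(addv_diff_cap Pi U') => /memv_addP[w wW [w' + ->]].
rewrite memv_cap => /andP[_]; rewrite memv_cap => /andP[_ /(memv_orth quadQ) hw'].
by rewrite (polarDr quadQ) // hw' // addr0 polarC h.
Qed.

Lemma solid_orthK U : (U <= Pi)%VS -> (Pi :&: polarity Q (Pi :&: polarity Q U))%VS = U.
Proof.
move=> UPi; apply/esym/eqP; rewrite eqEdim subv_cap UPi.
have -> : (U <= polarity Q (Pi :&: polarity Q U))%VS.
  exact/(orthC quadQ)/capvSr.
have := dim_solid_orth UPi; have := dim_solid_orth (capvSl Pi (polarity Q U)).
by lia.
Qed.

Lemma dim_tangent_plane x : x \in pts Pi -> \dim (tangent_plane x) = 3%N.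
Proof. by rewrite inE => /dim_solid_orth; rewrite dim_pt addn1 => -[]. Qed.

Lemma pt_isotropic x : (x <= polarity Q x)%VS.
Proof. by rewrite {1}point_span -memvE (orth_pt quadQ) // (polarvv q_even quadQ). Qed.

Lemma tangent_plane_pt x : x \in pts Pi -> x \in pts (tangent_plane x).
Proof. by rewrite !inE subv_cap pt_isotropic => ->. Qed.

Lemma tangent_planeC x y : x \in pts Pi -> y \in pts Pi ->
  (x \in pts (tangent_plane y)) = (y \in pts (tangent_plane x)).
Proof.
move=> xPi yPi; rewrite !pts_cap !(in_setI, xPi, yPi) /= !mem_pts.
by rewrite !(orth_pt quadQ) // polarC.
Qed.

(** The lines of W(q) are the totally isotropic lines. If the only singular point of [L] were not
    orthogonal to [L], there would be a second one. Conversely, on an isotropic line Q is additive,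
    so square roots yield a singular point, and it is unique by [singular_line]. *)
Lemma W_lineP L :
  reflect [/\ \dim L = 2%N, (L <= Pi)%VS & (L <= polarity Q L)%VS] (W_line Q Pi L).
Proof.
rewrite /W_line /section_quadric; apply: (iffP and3P) => [[/eqP dL LPi]|[dL LPi /subvP isoL]].
  move=> /cards1P[P eP]; split=> //.
  have : P \in pts L :&: (pts Pi :&: quadric Q) by rewrite eP inE.
  rewrite !in_setI (mem_quadric quadQ) // mem_pts => /and3P[PL _ /eqP QP].
  have b0 v : v \in L -> b (rep P) v = 0.
    move=> vL; apply/eqP; apply/negP => /negP bP.
    (* The second singular point on the line joining [P] and [v]: Q(v - k P) = Q(v) - k b(v, P)
       vanishes for this k. *)
    set w := v - (Q v / b (rep P) v) *: rep P.
    have bPw : b (rep P) w = b (rep P) v.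
      by rewrite /w -scaleNr (polarDr quadQ) (polarZr quadQ) (polarvv q_even quadQ) mulr0 addr0.
    have w0 : w != 0 by apply: contraNneq bP => w0; rewrite -bPw w0 (polar0r quadQ).
    have Qw : Q w = 0.
      rewrite /w -scaleNr quadD (quadZ quadQ) QP mulr0 addr0 (polarZr quadQ).
      by rewrite [b v _]polarC mulNr divfK // subrr.
    have [R eR] := point_of w0.
    have wL : w \in L by rewrite memvB // memvZ.
    have : R \in [set P].
      rewrite -eP !in_setI (mem_quadric quadQ) inE eR -memvE wL inE eR -memvE (subvP LPi _ wL) /=.
      by rewrite (quad_scalar_eq0 quadQ (rep_neq0 R) (w := w)) ?Qw // -eR mem_rep.
    rewrite inE => /eqP RP; move: (memv_line w).
    rewrite -eR RP point_span => /vlineP[k] /(congr1 (b (rep P))).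
    rewrite bPw (polarZr quadQ) (polarvv q_even quadQ) mulr0 => b0.
    by rewrite b0 eqxx in bP.
  apply/subvP => v vL; apply/(memv_orth quadQ) => u uL.
  have [M eM] : exists w, L = (<[rep P]> + <[w]>)%VS.
    have [w wL wP] : exists2 w, w \in L & w \notin <[rep P]>%VS.
      apply/subvPn; apply/negP => /dimvS; rewrite dL dim_vline; by case: eqP.
    exists w; apply/esym/eqP; rewrite eqEdim subv_add -!memvE PL wL dL /=.
    have w0 : w != 0 by apply: contraNneq wP => ->; rewrite mem0v.
    have [R eR] := point_of w0.
    rewrite -(point_span P) -eR dim_join //; apply: contraNneq wP => ->.
    by rewrite -(point_span R) eR memv_line.
  move: uL vL; rewrite eM.
  move=> /memv_addP[_ /vlineP[k ->] [_ /vlineP[l ->] ->]].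
  move=> /memv_addP[_ /vlineP[k' ->] [_ /vlineP[l' ->] ->]].
  have ML : M \in L by rewrite eM memvE addvSr.
  rewrite !(polarDl quadQ) !(polarDr quadQ) !(polarZl quadQ) !(polarZr quadQ) !(polarvv q_even quadQ) //.
  by rewrite [b M _]polarC b0 // !mulr0 !addr0.
split=> //; first exact/eqP.
rewrite setIA (_ : pts L :&: pts Pi = pts L); last first.
  by apply/setIidPl; apply: ptsS.
have iso u v : u \in L -> v \in L -> b u v = 0.
  by move=> uL /isoL /(memv_orth quadQ); apply.
have [P [PL QP]] : exists P, P \in pts L /\ Q (rep P) = 0.
  pose s := vpick L; have s0 : s != 0 by rewrite vpick0 -dimv_eq0 dL.
  have sL : s \in L by apply: memv_pick.
  suff [v [vL v0 Qv]] : exists v, [/\ v \in L, v != 0 & Q v = 0].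
    have [P eP] := point_of v0; exists P; rewrite inE eP -memvE; split=> //.
    by apply/eqP; rewrite (quad_scalar_eq0 quadQ (rep_neq0 P) (w := v)) ?Qv // -eP mem_rep.
  have [Qs|Qs] := eqVneq (Q s) 0; first by exists s.
  have [w wL ws] : exists2 w, w \in L & w \notin <[s]>%VS.
    apply/subvPn; apply/negP => /dimvS; rewrite dL dim_vline; by case: eqP.
  have [c e] := sqrt_exists q_even (Q w / Q s).
  exists (w + c *: s); split; first by rewrite memvD // memvZ.
    apply: contraNneq ws => /eqP; rewrite addr_eq0 => /eqP ->.
    by rewrite memvN memvZ // memv_line.
  by rewrite (quad_isotropic quadQ) ?iso // e divfK // (addrr_even q_even).
apply/cards1P; exists P; apply/setP => R; rewrite in_setI in_set1 (mem_quadric quadQ) //.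
apply/andP/eqP => [[RL /eqP QR]|->]; last by rewrite PL QP.
apply/eqP; rewrite -pt_subE point_span -memvE point_span.
rewrite !mem_pts in RL PL.
by apply: singular_line; rewrite ?rep_neq0 ?(subvP LPi) ?iso.
Qed.

Lemma W_line_join x m : x \in pts Pi -> m \in pts (tangent_plane x) -> m != x ->
  W_line Q Pi (x + m).
Proof.
rewrite !inE subv_cap => xPi /andP[mPi mx] m_x; apply/W_lineP; split.
- by rewrite dim_join // eq_sym.
- by rewrite subv_add xPi.
rewrite (orthD quadQ) subv_cap !subv_add !pt_isotropic mx /=.
by rewrite (orthC quadQ mx).
Qed.

(** * Counting ovoid points in tangent planes and on lines *)

Lemma compl_pt x U : x \in pts U ->
  exists M, [/\ x \notin pts M, (x + M)%VS = U & (\dim M).+1 = \dim U].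
Proof.
rewrite inE => xU; have e : (x + (U :\: x))%VS = U.
  by rewrite addvC addv_diff; apply/addv_idPl.
have xM : x \notin pts (U :\: x).
  apply/negP; rewrite inE => xM.
  have : (x <= (U :\: x) :&: x)%VS by rewrite subv_cap xM subvv.
  by move=> /dimvS; rewrite capv_diff dimv0 dim_pt.
by exists (U :\: x)%VS; split=> //; rewrite -(dim_addpt xM) e.
Qed.

Lemma line_join x L : \dim L = 2%N -> x \in pts L ->
  exists m, m != x /\ (x + m)%VS = L.
Proof.
move=> dL /compl_pt[M [xM e]]; rewrite dL => -[/dim1_pt[m em]].
by exists m; rewrite em e; split=> //; apply: contraNneq xM => <-; rewrite -em inE.
Qed.

(** The q + 1 lines through [x] in its tangent plane are lines of W(q), each with exactly one ovoid
    point: always [x] if [x] is in [O], and q + 1 distinct points otherwise. *)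
Lemma card_tangent_plane O x : W_ovoid Q Pi O -> x \in pts Pi ->
  #|pts (tangent_plane x) :&: O| = if x \in O then 1%N else q.+1.
Proof.
move=> [_ ovO] xPi; have xT := tangent_plane_pt xPi.
have [M [xM e]] := compl_pt xT; rewrite dim_tangent_plane // => -[dM].
rewrite (cardsD1 x) !in_setI xT /= -e pencil_count //.
rewrite (eq_bigr (fun=> if x \in O then 0%N else 1%N)) => [|m mM].
  by case: ifP => _; rewrite sum_nat_const ?muln0 ?muln1 ?card_pts_line.
have mx : m != x by apply: contraNneq xM => <-.
have : W_line Q Pi (x + m).
  apply: W_line_join => //; apply: subsetP (ptsS _) _ mM.
  by rewrite -e addvSr.
move=> /ovO; rewrite (cardsD1 x) in_setI inE addvSl /=.
by case: (x \in O) => /= -[].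
Qed.

(** One term is moved to the left to avoid truncated subtraction. *)
Lemma sum_if_in (T : finType) (A B : {set T}) (c d : nat) :
  (\sum_(x in A) (if x \in B then c else d)
     + d * #|A :&: B| = c * #|A :&: B| + d * #|A|)%N.
Proof.
rewrite -(cardsID B A) (bigID (mem B)) /=.
rewrite (eq_bigr (fun=> c)) => [|x /andP[_ ->] //].
rewrite [X in (_ + X + _)%N](eq_bigr (fun=> d)) => [|x /andP[_ /negbTE ->] //].
rewrite !sum_nat_cond_const.
have -> : [set x in A | x \in B] = A :&: B by apply/setP => x; rewrite !inE.
have -> : [set x in A | x \notin B] = A :\: B by apply/setP => x; rewrite !inE andbC.
nia.
Qed.

(** Count orthogonal pairs of a point [x] of [L] and a point [z] of [O]. A given [x] has 1 or q + 1
    partners by [card_tangent_plane]; a given [z] is orthogonal to all q + 1 points of [L] if it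
    lies on the polar line, and to exactly one otherwise. *)
Lemma line_count O L : W_ovoid Q Pi O -> \dim L = 2%N -> (L <= Pi)%VS ->
  (#|O| + q * (#|pts L :&: O| + #|pts (Pi :&: polarity Q L) :&: O|) = q.+1 ^ 2)%N.
Proof.
move=> ovO dL LPi; have [OPi _] := ovO.
have := double_count (pts L) O (fun x z => z \in pts (tangent_plane x)).
rewrite (eq_bigr (fun x => if x \in O then 1%N else q.+1)) => [|x xL]; last first.
  rewrite -(card_tangent_plane ovO); last exact: (subsetP (ptsS LPi)).
  by apply: eq_card => z; rewrite !inE andbC.
rewrite [in RHS](eq_bigr (fun z => if z \in pts (Pi :&: polarity Q L) then q.+1 else 1%N)).
  have := sum_if_in (pts L) O 1 q.+1; rewrite card_pts_line //.
  have := sum_if_in O (pts (Pi :&: polarity Q L)) q.+1 1.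
  rewrite [O :&: _]setIC -mulnn !mulnDr => e1 e2 e3; move: e1 e2; rewrite -e3.
  move: (\sum_(x in pts L) _)%N #|pts L :&: O| #|pts _ :&: O| => S k k'; nia.
move=> z zO; have zPi := subsetP OPi z zO.
have -> : [set x in pts L | z \in pts (tangent_plane x)] = pts (L :&: tangent_plane z).
  apply/setP => x; rewrite in_set (pts_cap L) in_setI; case xL: (x \in pts L) => //=.
  by rewrite tangent_planeC // (subsetP (ptsS LPi)).
rewrite capvA (capv_idPl LPi).
have zL : (z \in pts (Pi :&: polarity Q L)) = (L <= polarity Q z)%VS.
  rewrite pts_cap in_setI zPi inE /=.
  by apply/idP/idP => /(orthC quadQ).
rewrite zL; case: ifP => [/capv_idPl -> |h]; first by rewrite card_pts_line.
apply: card_pts_dim1.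
have := dim_cap_orth quadQ L z; rewrite dL dim_pt => h1.
have := dimv_leqif_eq (capvSl L (polarity Q z)); rewrite dL => -[h2 h3].
have : (L :&: polarity Q z != L)%VS by apply: contraFneq h => <-; apply: capvSr.
by rewrite -h3; lia.
Qed.

Lemma exists_W_line : exists L, W_line Q Pi L.
Proof.
have [x xPi] : exists x, x \in pts Pi.
  have v0 : vpick Pi != 0 by rewrite vpick0 -dimv_eq0 dimPi.
  by have [x ex] := point_of v0; exists x; rewrite inE ex -memvE memv_pick.
have [M [xM e]] := compl_pt (tangent_plane_pt xPi).
rewrite dim_tangent_plane // => -[dM].
have v0 : vpick M != 0 by rewrite vpick0 -dimv_eq0 dM.
have [m em] := point_of v0; have mM : m \in pts M by rewrite inE em -memvE memv_pick.
exists (x + m)%VS; apply: W_line_join => //; last by apply: contraNneq xM => <-.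
by apply: subsetP (ptsS _) _ mM; rewrite -e addvSr.
Qed.

(** A line of W(q) is its own polar line, so both intersection numbers in [line_count] are 1. *)
Lemma card_ovoid O : W_ovoid Q Pi O -> #|O| = (q ^ 2).+1.
Proof.
move=> ovO; have [L WL] := exists_W_line; have [dL LPi isoL] := W_lineP L WL.
have -> : #|O| = (q.+1 ^ 2 - q * 2)%N; last by rewrite -!mulnn; nia.
rewrite -(line_count ovO dL LPi).
have e : (Pi :&: polarity Q L)%VS = L.
  have := dim_solid_orth LPi; rewrite dL => d.
  apply/esym/eqP; rewrite eqEdim subv_cap LPi isoL /=; lia.
by rewrite e; have [_ ->] := ovO; rewrite // addnK.
Qed.

Lemma line_polar_count O L : W_ovoid Q Pi O -> \dim L = 2%N -> (L <= Pi)%VS ->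
  (#|pts L :&: O| + #|pts (Pi :&: polarity Q L) :&: O| = 2)%N.
Proof.
move=> ovO dL LPi; have := line_count ovO dL LPi; rewrite card_ovoid //.
have := finNzRing_gt1 F; rewrite -!mulnn => q1 e; apply/eqP.
by rewrite -(eqn_pmul2l (ltnW q1)); apply/eqP; move: e; move: #|F| #|pts L :&: O| #|pts _ :&: O| => c k k'; nia.
Qed.

(** Dimensions below 2 are allowed because it is applied to projections of [L :&: p], with [L] not
    necessarily in the plane [p]. *)
Lemma card_line_le2 O L : W_ovoid Q Pi O -> (\dim L <= 2)%N -> (L <= Pi)%VS ->
  (#|pts L :&: O| <= 2)%N.
Proof.
move=> ovO; rewrite leq_eqVlt => /orP[/eqP dL LPi|dL _].
  by rewrite -(line_polar_count ovO dL LPi) leq_addr.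
apply: leq_trans (subset_leq_card (subsetIl _ _)) _.
have [d0|d0] := posnP (\dim L); last by rewrite card_pts_dim1 //; lia.
rewrite (_ : pts L = set0) ?cards0 //; apply/setP=> P; rewrite !inE.
by apply/negP => /dimvS; rewrite dim_pt d0.
Qed.

(* The [q] lines of the plane through [P] other than [Px] have to share the
   remaining [q] points of the oval, so none of them is a tangent. *)
Lemma tangent_through_pole O x L : W_ovoid Q Pi O -> x \in pts Pi -> x \notin O ->
  (L <= tangent_plane x)%VS -> \dim L = 2%N -> #|pts L :&: O| = 1%N -> x \in pts L.
Proof.
move=> ovO xPi xO LT dL /eqP/cards1P[P eP]; apply/negPn/negP => xL.
have := card_tangent_plane ovO xPi; rewrite (negbTE xO).
have /setIP[PL PO] : P \in pts L :&: O by rewrite eP inE.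
have [l [lP eL]] := line_join dL PL.
have lL : (l <= L)%VS by rewrite -eL addvSr.
have xl : x != l by apply: contraNneq xL => ->; rewrite inE.
(* The line [x + l] misses [P], so its points index the pencil of lines through [P] in the tangent
   plane. *)
have PM : P \notin pts (x + l).
  apply: contra xL; rewrite !inE => PM.
  have /dimv_leqif_eq/geq_leqif : (L <= x + l)%VS by rewrite -eL subv_add PM addvSr.
  by rewrite dL dim_join // => /esym/eqP ->; rewrite addvSl.
have PT : P \in pts (tangent_plane x) by apply: subsetP (ptsS LT) _ PL.
have eT : (P + (x + l))%VS = tangent_plane x.
  apply/eqP; rewrite eqEdim dim_tangent_plane // dim_addpt // dim_join // andbT.
  have := tangent_plane_pt xPi; rewrite !inE in PT * => xT.
  by rewrite !subv_add PT xT (subv_trans lL).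
rewrite (cardsD1 P) in_setI PT PO add1n -{1}eT pencil_count // => -[].
have lM : l \in pts (x + l) by rewrite inE addvSr.
have xM : x \in pts (x + l) by rewrite inE addvSl.
rewrite (bigD1 l) //= (bigD1 x) /=; last by rewrite xM.
have -> : #|(pts (P + l) :&: O) :\ P| = 0%N.
  by rewrite eL eP setDv cards0.
have -> : #|(pts (P + x) :&: O) :\ P| = 0%N.
  have : W_line Q Pi (P + x).
    rewrite addvC; apply: W_line_join => //.
    by apply: contraNneq xL => <-.
  have [_ h] := ovO; move=> /h; rewrite (cardsD1 P) in_setI PO inE addvSl.
  by move=> -[].
rewrite !add0n => e.
(* The lines [L] and [P + x] contain no ovoid point besides [P], so the other q - 1 lines, with at
   most one further point each, would have to carry q points. *)
have : (\sum_(m in pts (x + l) | (m != l) && (m != x)) #|(pts (P + m) :&: O) :\ P|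
   <= \sum_(m in pts (x + l) | (m != l) && (m != x)) 1)%N.
  apply: leq_sum => m /andP[mM _].
  have mP : P != m by apply: contraNneq PM => ->.
  have : (#|pts (P + m) :&: O| <= 2)%N.
    apply: card_line_le2 => //; first by rewrite dim_join.
    apply: subv_trans (capvSl Pi (polarity Q x)); rewrite -eT.
    by apply: addvS => //; rewrite inE in mM.
  by rewrite (cardsD1 P) in_setI PO inE addvSl.
rewrite sum1dep_card (eq_bigl (fun m => (m \in pts (x + l)) && (m != l) && (m != x))) in e *; last first.
  by move=> m; rewrite andbA.
rewrite e.
rewrite (_ : #|_| = #|(pts (x + l) :\ l) :\ x|); last first.
  by apply: eq_card => m; rewrite !inE; do 2![case: eqP => //=]; rewrite ?andbF ?andbT.
have := cardsD1 l (pts (x + l)); have := cardsD1 x (pts (x + l) :\ l).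
rewrite lM !inE xl addvSl /= card_pts_line ?dim_join // => -> [->].
by rewrite add1n ltnn.
Qed.

(** If [L] met [O] once, so would its polar line, which then has a point [x] off [O]. Now [L] lies
    in the tangent plane of [x] and is tangent there, so it passes through [x] and is a line of
    W(q). *)
Lemma card_not_W_line O L : W_ovoid Q Pi O -> \dim L = 2%N -> (L <= Pi)%VS ->
  ~~ W_line Q Pi L -> #|pts L :&: O| != 1%N.
Proof.
move=> ovO dL LPi; apply: contra => /eqP c1.
have := line_polar_count ovO dL LPi; rewrite c1 => -[c1'].
have dL' : \dim (Pi :&: polarity Q L) = 2%N.
  by apply/eqP; rewrite -(eqn_add2r 2) -[in X in (_ + X)%N == _]dL dim_solid_orth.
have /subsetPn[x xL' xO] : ~~ (pts (Pi :&: polarity Q L) \subset O).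
  apply/negP => /setIidPl e; move: c1'; rewrite e card_pts_line //.
  by have := finNzRing_gt1 F; rewrite -ltnS => + [e0]; rewrite e0.
move: xL'; rewrite inE subv_cap => /andP[xPi xL'].
have LT : (L <= tangent_plane x)%VS by rewrite subv_cap LPi; apply: (orthC quadQ).
have xPi' : x \in pts Pi by rewrite inE.
have xL := tangent_through_pole ovO xPi' xO LT dL c1.
have [m [mx eL]] := line_join dL xL.
rewrite -eL; apply: W_line_join => //.
by rewrite inE (subv_trans _ LT) // -eL addvSr.
Qed.

Lemma elliptic_ovoid : W_ovoid Q Pi (section_quadric Q Pi).
Proof.
split; first exact: subsetIl.
by move=> L /and3P[_ _ /eqP].
Qed.

(** * Parity of ovoid intersections *)

Lemma natr_odd (m : nat) : m%:R = (odd m)%:R :> F.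
Proof. exact: (mulrn_odd q_even). Qed.

Lemma sum_indicator (T : finType) (A : {set T}) (p : pred T) :
  \sum_(z in A) (p z)%:R = #|[set z in A | p z]|%:R :> F.
Proof.
rewrite -sum1dep_card natr_sum [RHS]big_mkcondr; apply: eq_bigr => z _.
by case: (p z).
Qed.

Lemma odd_ovoid O : W_ovoid Q Pi O -> odd #|O|.
Proof. by move=> /card_ovoid ->; rewrite oddS oddX (negbTE q_even). Qed.

Lemma odd_tangent_plane O x : W_ovoid Q Pi O -> x \in pts Pi ->
  odd #|O :&: pts (tangent_plane x)|.
Proof.
by move=> ovO xPi; rewrite setIC card_tangent_plane //=; case: ifP => //= _; rewrite q_even.
Qed.

(** A line has at most two ovoid points, and exactly one precisely when it is a line of W(q); parity
    therefore detects orthogonality. *)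
Lemma odd_line O x y : W_ovoid Q Pi O -> x \in pts Pi -> y \in pts Pi -> x != y ->
  odd #|pts (x + y) :&: O| = (b (rep x) (rep y) == 0).
Proof.
move=> ovO xPi yPi xy.
have LPi : (x + y <= Pi)%VS by rewrite !inE in xPi yPi; rewrite subv_add xPi.
have WL : W_line Q Pi (x + y) = (b (rep x) (rep y) == 0).
  apply/idP/idP => [/W_lineP[_ _ iso]|bxy].
    rewrite -(orth_pt quadQ) -mem_pts inE; apply: subv_trans (addvSr x y) _.
    by apply: subv_trans iso _; apply: (orthS quadQ); apply: addvSl.
  apply: W_line_join; rewrite // 1?eq_sym //.
  by rewrite pts_cap in_setI yPi mem_pts (orth_pt quadQ).
rewrite -WL; have [W|nW] := boolP (W_line Q Pi (x + y)).
  by have [_ ->] := ovO.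
have dL := dim_join xy.
have := card_not_W_line ovO dL LPi nW; have := card_line_le2 ovO (eq_leq dL) LPi.
by case: #|_| => [|[|[|]]].
Qed.

(** A power q - 1 is the indicator of being nonzero, so the claim is that the number of ovoid points
    off both tangent planes is odd exactly when [b x y] is nonzero. By inclusion-exclusion only the
    parity on the intersection of the planes matters; this is the polar of the line joining the two
    points, which has the same parity as that line. *)
Lemma ovoid_power_sum O (x y : 'rV[F]_n) : W_ovoid Q Pi O -> x \in Pi -> y \in Pi ->
  \sum_(z in O) (b x (rep z) * b y (rep z)) ^+ q.-1 = b x y ^+ q.-1.
Proof.
move=> ovO xPi yPi; have [OPi _] := ovO.
rewrite expf_pred_card; under eq_bigr => z _ do rewrite expf_pred_card.
rewrite sum_indicator natr_odd; congr (_%:R); congr nat_of_bool.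
have [->|x0] := eqVneq x 0.
  rewrite (polar0l quadQ) eqxx (_ : [set z in O | _] = set0) ?cards0 //.
  by apply/setP => z; rewrite !inE (polar0l quadQ) mul0r eqxx andbF.
have [->|y0] := eqVneq y 0.
  rewrite (polar0r quadQ) eqxx (_ : [set z in O | _] = set0) ?cards0 //.
  by apply/setP => z; rewrite !inE (polar0l quadQ) mulr0 eqxx andbF.
have [X eX] := point_of x0; have [Y eY] := point_of y0.
have XPi : X \in pts Pi by rewrite inE eX -memvE.
have YPi : Y \in pts Pi by rewrite inE eY -memvE.
have perpX z : z \in O -> (z \in pts (tangent_plane X)) = (b x (rep z) == 0).
  by move=> /(subsetP OPi) zPi; rewrite pts_cap in_setI zPi mem_pts eX (orth_line quadQ).
have perpY z : z \in O -> (z \in pts (tangent_plane Y)) = (b y (rep z) == 0).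
  by move=> /(subsetP OPi) zPi; rewrite pts_cap in_setI zPi mem_pts eY (orth_line quadQ).
set A := pts (tangent_plane X) in perpX; set B := pts (tangent_plane Y) in perpY.
have -> : [set z in O | b x (rep z) * b y (rep z) != 0] = O :\: (A :|: B).
  apply/setP => z; rewrite in_setD in_setU andbC.
  case zO: (z \in O); last by rewrite inE zO.
  by rewrite perpX // perpY // inE zO mulf_eq0.
have h1 := cardsID (A :|: B) O; have h2 := cardsUI (O :&: A) (O :&: B).
rewrite -setIUr -setIIr in h2.
have o1 := odd_ovoid ovO; have o2 := odd_tangent_plane ovO XPi.
have o3 := odd_tangent_plane ovO YPi; rewrite -/A -/B in o2 o3.
have -> : odd #|O :\: (A :|: B)| = ~~ odd #|O :&: (A :&: B)|.
  move: (congr1 odd h1) (congr1 odd h2); rewrite !oddD o1 o2 o3.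
  by do 3!case: (odd _).
have xX : x \in (X : {vspace _}) by rewrite eX memv_line.
have bxy : (b x y == 0) = (b (rep X) (rep Y) == 0).
  rewrite -(orth_line quadQ) -eX -(orth_pt quadQ) -mem_pts inE.
  by rewrite eY -memvE.
(* For equal points the two planes coincide, with an odd number of ovoid points, while b
   vanishes. *)
rewrite bxy; have [eXY|XY] := eqVneq X Y.
  by rewrite /A /B -eXY setIid o2 (polarvv q_even quadQ) eqxx.
congr (~~ _); rewrite -(odd_line ovO XPi YPi XY).
have XYPi : (X + Y <= Pi)%VS by rewrite !inE in XPi YPi; rewrite subv_add XPi.
have := line_polar_count ovO (dim_join XY) XYPi.
rewrite (orthD quadQ) (_ : pts (Pi :&: _) :&: O = O :&: (A :&: B)).
  by move=> /(congr1 odd); rewrite oddD; do 2!case: (odd _).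
rewrite setIC /A /B -pts_cap; congr (_ :&: pts _).
by apply/vspaceP => v; rewrite !memv_cap; case: (v \in Pi).
Qed.

(** * Symplectic basis and trace of the quadratic form *)

Lemma hyperbolic_partner U e : (U <= Pi)%VS -> (U :&: polarity Q U = 0)%VS ->
  e \in U -> e != 0 -> exists2 f, f \in U & b e f = 1.
Proof.
move=> UPi U0 eU e0.
have /subvPn[f fU fe] : ~~ (U <= polarity Q <[e]>)%VS.
  apply: contra e0 => h; rewrite -memv0 -U0 memv_cap eU memvE.
  exact: (orthC quadQ).
rewrite (orth_line quadQ) in fe.
by exists ((b e f)^-1 *: f); rewrite ?memvZ // (polarZr quadQ) mulVf.
Qed.

Lemma hyperbolic_plane U e f : \dim U = 2%N -> e \in U -> f \in U -> b e f = 1 ->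
  forall z : 'rV[F]_n, z \in U -> z = b z f *: e + b z e *: f.
Proof.
move=> dU eU fU bef z zU.
have e0 : e != 0.
  by apply: contra_eq_neq bef => ->; rewrite (polar0l quadQ) eq_sym oner_eq0.
have fe : f \notin <[e]>%VS.
  apply: contra_eqN bef => /vlineP[k ->].
  by rewrite (polarZr quadQ) (polarvv q_even quadQ) mulr0 eq_sym oner_eq0.
have eqU : (<[e]> + <[f]>)%VS = U.
  apply/eqP; rewrite eqEdim subv_add -!memvE eU fU dU /=.
  rewrite ltnNge; apply: contra fe => h; rewrite memvE.
  have /dimv_leqif_eq/geq_leqif := addvSl <[e]> <[f]>.
  by rewrite dim_vline e0 h => /esym/eqP ->; rewrite addvSr.
move: zU; rewrite -eqU => /memv_addP[_ /vlineP[k ->] [_ /vlineP[l ->] ->]].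
rewrite !(polarDl quadQ) !(polarZl quadQ) !(polarvv q_even quadQ) [b f e]polarC bef.
by rewrite !mulr0 !mulr1 addr0 add0r.
Qed.

(* Along a symplectic basis [e1, f1, e2, f2] the form is
   [Q(e1) x1^2 + x1 y1 + Q(f1) y1^2 + Q(e2) x2^2 + x2 y2 + Q(f2) y2^2]; the two
   mixed terms contribute [b f1 e1 + b f2 e2 = 1 + 1] to the trace. *)
Lemma quad_decomposition : exists r : seq ('rV[F]_n * 'rV[F]_n),
  [/\ forall p, p \in r -> p.1 \in Pi /\ p.2 \in Pi,
      forall z : 'rV[F]_n, z \in Pi -> Q z = \sum_(p <- r) b p.1 z * b p.2 z
    & \sum_(p <- r) b p.1 p.2 = 0].
Proof.
have v0 : vpick Pi != 0 by rewrite vpick0 -dimv_eq0 dimPi.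
have [f1 f1Pi bef1] := hyperbolic_partner (subvv _) cap_orth_solid (memv_pick Pi) v0.
move: (vpick Pi) (memv_pick Pi) v0 bef1 => e1 e1Pi e1n0 bef1.
pose U := (<[e1]> + <[f1]>)%VS.
have UPi : (U <= Pi)%VS by rewrite subv_add -!memvE e1Pi.
have e1U : e1 \in U by rewrite memvE addvSl.
have f1U : f1 \in U by rewrite memvE addvSr.
have dU : \dim U = 2%N.
  apply/eqP; rewrite eqn_leq; apply/andP; split.
    apply: leq_trans (dimv_add_leqif _ _) _; rewrite !dim_vline.
    by do 2!case: (_ != 0).
  rewrite ltnNge; apply/negP => h.
  have /dimv_leqif_eq/geq_leqif := addvSl <[e1]> <[f1]>.
  rewrite dim_vline e1n0 h => /esym/eqP e; move: f1U; rewrite /U -e => /vlineP[k ek].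
  move: bef1; rewrite ek (polarZr quadQ) (polarvv q_even quadQ) mulr0 => /esym/eqP.
  by rewrite oner_eq0.
pose W := (Pi :&: polarity Q U)%VS.
have dW : \dim W = 2%N.
  by apply/eqP; rewrite -(eqn_add2r 2) -[in X in (_ + X)%N == _]dU dim_solid_orth.
have WPi : (W <= Pi)%VS by apply: capvSl.
have expU := hyperbolic_plane dU e1U f1U bef1.
(* A vector of [W] orthogonal to [W] lies in [U] by double orthogonality; being orthogonal to [U]
   too, it has zero coordinates in the basis [e1], [f1]. *)
have W0 : (W :&: polarity Q W = 0)%VS.
  apply/eqP; rewrite -subv0; apply/subvP => w; rewrite memv_cap => /andP[wW wW'].
  have wU : w \in U by rewrite -(solid_orthK UPi) memv_cap (subvP WPi).
  move: wW; rewrite memv_cap => /andP[_ /(memv_orth quadQ) h].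
  by rewrite (expU w) // ![b w _]polarC !h // !scale0r addr0 mem0v.
pose e2 := vpick W.
have e2W : e2 \in W by apply: memv_pick.
have e2n0 : e2 != 0 by rewrite vpick0 -dimv_eq0 dW.
have [f2 f2W bef2] := hyperbolic_partner WPi W0 e2W e2n0.
have expW := hyperbolic_plane dW e2W f2W bef2.
have [s1 es1] := sqrt_exists q_even (Q e1); have [t1 et1] := sqrt_exists q_even (Q f1).
have [s2 es2] := sqrt_exists q_even (Q e2); have [t2 et2] := sqrt_exists q_even (Q f2).
have e2Pi := subvP WPi _ e2W; have f2Pi := subvP WPi _ f2W.
have orthUW u w : u \in U -> w \in W -> b u w = 0.
  by move=> uU; rewrite memv_cap => /andP[_ /(memv_orth quadQ)]; apply.
(* The coordinate of [z] along [e1] is [b z f1], so Q(e1) x1^2 is the square of [b (s1 *: f1) z].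
   Such squares add nothing to the trace, since b is alternating. *)
exists [:: (s1 *: f1, s1 *: f1); (t1 *: e1, t1 *: e1); (f1, e1);
           (s2 *: f2, s2 *: f2); (t2 *: e2, t2 *: e2); (f2, e2)]; split.
- move=> p; rewrite !inE => /or4P[|||/or3P[]] /eqP -> /=; rewrite ?memvZ //.
- move=> z zPi; rewrite !big_cons big_nil /= addr0 !(polarZl quadQ).
  rewrite ![b _ z]polarC.
  pose u := b z f1 *: e1 + b z e1 *: f1.
  have uU : u \in U by rewrite memvD // memvZ.
  have zuW : z - u \in W.
    rewrite memv_cap memvB //=; last exact: (subvP UPi).
    rewrite /U (orthD quadQ) memv_cap !(orth_line quadQ) -scaleN1r /u.
    rewrite !(polarDr quadQ) !(polarZr quadQ) !(polarDr quadQ) !(polarZr quadQ).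
    rewrite !(polarvv q_even quadQ) [b f1 e1]polarC bef1.
    by rewrite ![b z _]polarC !mulr0 !mulr1 addr0 add0r !mulN1r !subrr eqxx.
  have ez : z = u + (z - u) by rewrite addrC subrK.
  have bz w : w \in W -> b (z - u) w = b z w.
    by move=> wW; rewrite [in RHS]ez [in RHS](polarDl quadQ) (orthUW u) // add0r.
  have -> : Q z = Q u + Q (z - u) by rewrite [in LHS]ez [LHS]quadD (orthUW u) // addr0.
  rewrite (expW _ zuW) !bz //.
  rewrite /u !quadD !(quadZ quadQ) !(polarZl quadQ) !(polarZr quadQ) bef1 bef2.
  by rewrite -es1 -es2 -et1 -et2; ring.
rewrite !big_cons big_nil /= !(polarZl quadQ) !(polarZr quadQ) !(polarvv q_even quadQ).
rewrite [b f1 e1]polarC [b f2 e2]polarC bef1 bef2 !mulr0 !add0r !addr0.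
exact: addrr_even.
Qed.

Lemma odd_ovoid_meet_quadric O : W_ovoid Q Pi O -> odd #|O :&: section_quadric Q Pi|.
Proof.
move=> ovO; have [OPi _] := ovO; have [r [rPi Qr beta0]] := quad_decomposition.
have [t [qt _]] := card_even q_even.
(* At [j = t] the factors in x and y have exponent 0, so both can be taken to be 0. What remains is
   the sum of Q(z)^(q-1), equal to the zero trace to the power q - 1. *)
have := power_sum_descent q_even quadQ OPi
  (fun x y : 'rV[F]_n => ovoid_power_sum ovO (x := x) (y := y)) rPi Qr qt (leqnn _)
  (mem0v Pi) (mem0v Pi).
rewrite subnn expn0 beta0 subn1 expr0 mulr1 expf_pred_card eqxx.
under eq_bigr => z _ do rewrite expr0 mulr1 expf_pred_card.
rewrite sum_indicator natr_odd.
have -> : [set z in O | Q (rep z) != 0] = O :\: section_quadric Q Pi.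
  apply/setP => z; rewrite in_setD in_setI (mem_quadric quadQ) andbC.
  case zO: (z \in O); last by rewrite inE zO.
  by rewrite (subsetP OPi) // inE zO.
move=> e; have ev : odd #|O :\: section_quadric Q Pi| = false.
  by apply/negP => h; move/eqP: e; rewrite h oner_eq0.
have := odd_ovoid ovO.
by rewrite -(cardsID (section_quadric Q Pi)) oddD ev addbF.
Qed.

(** * The Klein quadric *)

Hypothesis dimV : \dim {:'rV[F]_n} = 6%N.
Hypothesis hypQ : hyperbolic_on Q fullv.
Local Notation perp := (polarity Q Pi).
Local Notation proj := (daddv_pi Pi (polarity Q Pi)).

Lemma solid_perp_full : (Pi + perp)%VS = fullv.
Proof.
apply/eqP; rewrite eqEdim subvf dimV dimv_disjoint_sum ?cap_orth_solid // dimPi.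
have := dim_cap_orth quadQ fullv Pi; rewrite dimV dimPi capfv; lia.
Qed.

Lemma dim_perp : \dim perp = 2%N.
Proof.
have := dimv_disjoint_sum cap_orth_solid; rewrite solid_perp_full dimV dimPi.
by move=> /eqP; rewrite -[6%N]/(4 + 2)%N eqn_add2l => /eqP <-.
Qed.

Lemma proj_solid v : proj v \in Pi.
Proof. exact: memv_pi. Qed.

Lemma sub_proj v : v - proj v \in perp.
Proof.
have vV : v \in (Pi + perp)%VS by rewrite solid_perp_full memvf.
by rewrite -{1}(daddv_pi_add cap_orth_solid vV) addrC addKr memv_pi.
Qed.

Lemma proj_id v : v \in Pi -> proj v = v.
Proof. exact/daddv_pi_id/cap_orth_solid. Qed.

Lemma proj_eq0 v : proj v = 0 -> v \in perp.
Proof. by move=> e; have := sub_proj v; rewrite e subr0. Qed.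

Lemma polar_perp u v : u \in Pi -> v \in perp -> b u v = 0.
Proof. by move=> uPi /(memv_orth quadQ); apply. Qed.

Lemma polar_proj u v : u \in Pi -> b u (proj v) = b u v.
Proof.
move=> uPi; rewrite -[in RHS](subrK (proj v) v) [in RHS](polarDr quadQ).
by rewrite (polar_perp uPi (sub_proj v)) add0r.
Qed.

Lemma quad_proj v : Q v = Q (proj v) + Q (v - proj v).
Proof.
rewrite -[in LHS](subrK (proj v) v) addrC [LHS]quadD.
by rewrite (polar_perp (proj_solid v) (sub_proj v)) addr0.
Qed.

Lemma singular_plane_exists : exists2 W, totally_singular Q W & \dim W = 3%N.
Proof.
have [W [_ sW dW]] := witt_attained quadQ fullv; exists W; rewrite // dW.
have /andP[_] := hypQ; rewrite dimV; move: (witt_index _ _) => k; lia.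
Qed.

Lemma dim_singular_le3 W : totally_singular Q W -> (\dim W <= 3)%N.
Proof.
move=> sW; have := leq_witt (subvf W) sW.
have /andP[_] := hypQ; rewrite dimV; move: (witt_index _ _) => k; lia.
Qed.

(** At least 3 + 4 - 6 by dimensions, and at most 1 because [Pi] contains no singular line. *)
Lemma dim_singular_cap W : totally_singular Q W -> \dim W = 3%N ->
  \dim (W :&: Pi) = 1%N.
Proof.
move=> sW dW; apply/eqP; rewrite eqn_leq dim_singular_le1 ?capvSr //=; last first.
  apply/(totally_singularP) => v; rewrite memv_cap => /andP[vW _].
  by move/totally_singularP: sW; apply.
have := dimv_sum_cap W Pi; have := dimvS (subvf (W + Pi)).
rewrite dimV dW dimPi; lia.
Qed.

(* A singular vector [v] of [perp] would lie in every plane [W] of the quadric,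
   since [W] projects onto [perp]; it would then be orthogonal to [perp]. *)
Lemma perp_anisotropic v : v \in perp -> Q v = 0 -> v = 0.
Proof.
move=> vp Qv; have [W sW dW] := singular_plane_exists.
have dWPi := dim_singular_cap sW dW.
have [x ex] := dim1_pt dWPi.
have xWPi : rep x \in (W :&: Pi)%VS by rewrite -ex mem_rep.
have [xW xPi] : rep x \in W /\ rep x \in Pi by apply/andP; rewrite -memv_cap.
have sing u : u \in W -> Q u = 0 by move/totally_singularP: sW; apply.
(* The projection of [W] to [perp] along [Pi] has its kernel inside [W :&: Pi], of dimension 1, so
   its rank is at least 2, the dimension of [perp]. *)
have Wperp w : w \in perp -> exists2 e, e \in W & e - w \in Pi.
  move=> wp; have Wker : (W :&: lker (daddv_pi perp Pi) <= W :&: Pi)%VS.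
    apply: capvS => //; apply/subvP => u; rewrite memv_ker => /eqP u0.
    have uV : u \in (Pi + perp)%VS by rewrite solid_perp_full memvf.
    by rewrite -(daddv_pi_add cap_orth_solid uV) u0 addr0 memv_pi.
  have eW : (daddv_pi perp Pi @: W)%VS = perp.
    apply/eqP; rewrite eqEdim dim_perp; apply/andP; split.
      by apply/subvP => _ /memv_imgP[u _ ->]; apply: memv_pi.
    have := limg_ker_dim (daddv_pi perp Pi) W; have := dimvS Wker.
    rewrite dW dWPi; lia.
  move: wp; rewrite -{1}eW => /memv_imgP[e eW' ew]; exists e => //.
  have eV : e \in (Pi + perp)%VS by rewrite solid_perp_full memvf.
  by rewrite -{1}(daddv_pi_add cap_orth_solid eV) ew addrK memv_pi.
(* The vector [e - v] of [Pi] is singular and orthogonal to [x], hence a multiple of [rep x], which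
   lies in [W]; so [v] lies in [W]. *)
have [e eW aPi] := Wperp v vp.
have aW : e - v \in W.
  have : e - v \in <[rep x]>%VS.
    apply: singular_line; rewrite ?rep_neq0 //; first exact: sing.
      have := sing e eW; rewrite -[e in Q e](subrK v) quadD Qv addr0.
      by rewrite (polar_perp aPi vp) addr0.
    rewrite -scaleN1r (polarDr quadQ) (polarZr quadQ) (polar_perp xPi vp) mulr0 addr0.
    exact: (singular_orth sW xW eW).
  by rewrite -point_span ex memv_cap => /andP[].
have vW : v \in W by rewrite -[v](subKr e) memvB.
have /andP[/forall_inP/(_ v (memvf v)) + _] := hypQ.
rewrite Qv eqxx /= => /implyP h; apply/eqP/h; apply/forall_inP => u _; apply/eqP.
(* [v] is orthogonal to [Pi], and also to every [w] in [perp], because [w] differs by a vector of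
   [Pi] from a vector of [W]. *)
have : u \in (Pi + perp)%VS by rewrite solid_perp_full memvf.
move=> /memv_addP[a aPi' [w wp ->]]; rewrite (polarDr quadQ) polarC (polar_perp aPi' vp).
have [e' e'W aPi''] := Wperp w wp.
rewrite add0r -[w](subKr e') -scaleN1r (polarDr quadQ) (polarZr quadQ).
rewrite (singular_orth sW vW e'W) [b v _]polarC (polar_perp aPi'' vp).
by rewrite mulr0 addr0.
Qed.

(** * Projection of the quadric to the solid *)

Lemma proj_ker_singular L : totally_singular Q L -> (L :&: lker proj = 0)%VS.
Proof.
move=> /totally_singularP sL; apply/eqP; rewrite -subv0; apply/subvP => v.
rewrite memv_cap memv_ker memv0 => /andP[vL /eqP/proj_eq0 vp].
by apply/eqP/perp_anisotropic => //; apply: sL.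
Qed.

Lemma proj_inj_singular L u v : totally_singular Q L -> u \in L -> v \in L ->
  proj u = proj v -> u = v.
Proof.
move=> /proj_ker_singular L0 uL vL e; apply/eqP; rewrite -subr_eq0 -memv0 -L0.
by rewrite memv_cap memvB // memv_ker linearB /= e subrr.
Qed.

(** A plane containing all lines of W(q) through [x] contains every point of the tangent plane,
    since each is joined to [x] by such a line. *)
Lemma W_planeE x : x \in pts Pi -> W_plane Q Pi x = tangent_plane x.
Proof.
move=> xPi; have xT := tangent_plane_pt xPi; have dT := dim_tangent_plane xPi.
have TL L : W_line Q Pi L -> x \in pts L -> (L <= tangent_plane x)%VS.
  move=> /W_lineP[_ LPi iso]; rewrite inE => xL; rewrite subv_cap LPi.
  by rewrite (subv_trans iso) // (orthS quadQ).
rewrite /W_plane; case: pickP => [p /and3P[/eqP dp pPi /forallP h]|/(_ (tangent_plane x))].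
  apply/esym/eqP; rewrite eqEdim dT dp leqnn andbT.
  have lines m : m \in pts (tangent_plane x) -> m != x -> (x + m <= p)%VS.
    move=> mT mx; have /implyP := h (x + m)%VS; apply.
    by rewrite W_line_join // inE addvSl.
  have xp : (x <= p)%VS.
    have [M [xM eM]] := compl_pt xT; rewrite dT => -[dM].
    have v0 : vpick M != 0 by rewrite vpick0 -dimv_eq0 dM.
    have [m em] := point_of v0; have mM : m \in pts M by rewrite inE em -memvE memv_pick.
    apply: subv_trans (addvSl x m) _; apply: lines; last by apply: contraNneq xM => <-.
    by apply: subsetP (ptsS _) _ mM; rewrite -eM addvSr.
  apply/pts_subP/subsetP => m mT; rewrite inE; have [->//|mx] := eqVneq m x.
  by apply: subv_trans (lines m mT mx); apply: addvSr.
rewrite dT eqxx capvSl /= => /forallP[] L; apply/implyP => /andP[WL xL]; exact: TL.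
Qed.

(** Within [Pi] the polar of the tangent plane is [x], and projecting does not change b against
    [Pi]. Hence [conic_at] consists of the singular points projecting to [x]. *)
Lemma memv_W_plane_polarity x v : x \in pts Pi ->
  (v \in polarity Q (W_plane Q Pi x)) = (proj v \in (x : {vspace _})).
Proof.
move=> xPi; rewrite W_planeE //; have := xPi; rewrite inE => /solid_orthK eK.
rewrite -[in RHS]eK memv_cap proj_solid /=.
apply/idP/idP => /(memv_orth quadQ) h; apply/(memv_orth quadQ) => u uT.
  by rewrite polar_proj ?h //; exact: subvP (capvSl _ _) _ uT.
by rewrite -polar_proj ?h //; exact: subvP (capvSl _ _) _ uT.
Qed.

(** A point of [perp] projects to zero, whence the default in [insubd]; by anisotropy this never
    happens on the quadric. *)
Definition proj_pt y : point F n := insubd y (proj @: y)%VS.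

Lemma proj_ptE y : y \in quadric Q -> proj_pt y = (proj @: y)%VS :> {vspace _}.
Proof.
rewrite inE => sy; rewrite /proj_pt -[LHS]/(val _) insubdK // unfold_in /=.
by rewrite limg_dim_eq ?proj_ker_singular // dim_pt.
Qed.

Lemma proj_pt_mem y z : y \in quadric Q -> proj (rep y) \in (z : {vspace _}) -> proj_pt y = z.
Proof.
move=> yQ yz; apply/eqP; rewrite -pt_subE proj_ptE // [X in (_ @: X)%VS]point_span.
by rewrite limg_line -memvE.
Qed.

Lemma mem_proj_pt y : y \in quadric Q -> proj (rep y) \in (proj_pt y : {vspace _}).
Proof. by move=> yQ; rewrite proj_ptE // memv_img // mem_rep. Qed.

(** This treats both pieces of the set uniformly. If [y] projects to a singular point, then Q(y -
    proj y) = 0, so anisotropy gives [proj y = y] and [y] already lies in [Pi]. *)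
Lemma mem_ovoid_set O y : W_ovoid Q Pi O ->
  (y \in ovoid_set Q Pi O) = (y \in quadric Q) && (proj_pt y \in O).
Proof.
move=> [OPi _]; rewrite in_setU; apply/orP/andP => [[/bigcupP[P]|]|[yQ yO]].
- rewrite in_setD => /andP[_ PO] /setIP[]; rewrite mem_pts memv_W_plane_polarity.
    by move=> yP yQ; rewrite (proj_pt_mem yQ yP).
  exact: (subsetP OPi).
- rewrite !in_setI mem_pts => /and3P[yO yPi yQ].
  by rewrite (proj_pt_mem (z := y)) // proj_id // mem_rep.
have PPi := subsetP OPi _ yO; have yP := mem_proj_pt yQ.
have [PQ|PQ] := boolP (proj_pt y \in section_quadric Q Pi); last first.
  left; apply/bigcupP; exists (proj_pt y); first by rewrite in_setD PQ.
  by rewrite in_setI yQ andbT mem_pts memv_W_plane_polarity.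
right; suff e : proj (rep y) = rep y.
  have eP : proj_pt y = y by apply: proj_pt_mem => //; rewrite e mem_rep.
  by rewrite in_setI -{1}eP yO -eP.
have Qp : Q (proj (rep y)) = 0.
  move: PQ; rewrite in_setI (mem_quadric quadQ) => /andP[_ /eqP Q0].
  by move: yP; rewrite point_span => /vlineP[k ->]; rewrite (quadZ quadQ) Q0 mulr0.
have /eqP := yQ; rewrite (mem_quadric quadQ) => /eqP; rewrite quad_proj Qp add0r.
move=> /eqP /(perp_anisotropic (sub_proj _)) /eqP.
by rewrite subr_eq0 => /eqP <-.
Qed.

Lemma card_singular_ovoid_set O L : W_ovoid Q Pi O -> totally_singular Q L ->
  #|pts L :&: ovoid_set Q Pi O| = #|pts (proj @: L) :&: O|.
Proof.
move=> ovO sL; have LQ y : y \in pts L -> y \in quadric Q.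
  by apply/subsetP; rewrite (singular_pts quadQ).
rewrite -(card_in_imset (f := proj_pt)) => [|y y'].
  apply: eq_card => z; rewrite in_setI; apply/imsetP/andP => [[y]|[]].
    rewrite in_setI mem_ovoid_set // => /and3P[yL yQ yO] ->; split=> //.
    by rewrite inE proj_ptE // limgS //; rewrite inE in yL.
  rewrite mem_pts => /memv_imgP[v vL ev] zO.
  have v0 : v != 0 by apply: contra_eq_neq ev => ->; rewrite linear0 rep_neq0.
  have [y ey] := point_of v0; have yL : y \in pts L by rewrite inE ey -memvE.
  have ez : proj_pt y = z.
    apply: proj_pt_mem; first exact: LQ.
    have : rep y \in <[v]>%VS by rewrite -ey mem_rep.
    by move=> /vlineP[k ->]; rewrite linearZ /= -ev memvZ // mem_rep.
  by exists y; rewrite ?in_setI ?mem_ovoid_set ?yL ?LQ ?ez.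
rewrite !in_setI => /andP[yL _] /andP[y'L _] e.
have := mem_proj_pt (LQ _ yL); rewrite e proj_ptE ?LQ //.
rewrite [X in (_ @: X)%VS]point_span limg_line => /vlineP[k].
rewrite -linearZ /= !mem_pts in yL y'L * => /(proj_inj_singular sL yL).
rewrite memvZ // => /(_ isT) ey; apply/eqP; rewrite -pt_subE [X in (X <= _)%VS]point_span.
by rewrite -memvE ey memvZ // mem_rep.
Qed.

(** The plane is orthogonal to its point [x] in [Pi], so its projection lies in the tangent plane of
    [x]; injectivity makes the dimensions equal. *)
Lemma quadric_plane_base p : quadric_plane Q p ->
  exists x, [/\ x \in section_quadric Q Pi, x = (p :&: Pi)%VS :> {vspace _}
              & (proj @: p)%VS = tangent_plane x].
Proof.
rewrite /quadric_plane (singular_pts quadQ) => /andP[/eqP dp sp].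
have [x ex] := dim1_pt (dim_singular_cap sp dp); exists x.
have /subvP xp : (x <= p)%VS by rewrite ex capvSl.
have xPi : (x <= Pi)%VS by rewrite ex capvSr.
have xPi' : x \in pts Pi by rewrite inE.
split=> //.
  rewrite in_setI xPi' (mem_quadric quadQ); apply/eqP.
  by move/totally_singularP: sp; apply; exact: (xp _ (mem_rep x)).
apply/eqP; rewrite eqEdim dim_tangent_plane // limg_dim_eq ?proj_ker_singular // dp.
rewrite andbT; apply/subvP => _ /memv_imgP[v vp ->].
rewrite memv_cap proj_solid (orth_pt quadQ) polar_proj; last exact: subvP xPi _ (mem_rep x).
by rewrite (singular_orth sp (xp _ (mem_rep x)) vp) eqxx.
Qed.

(** If a singular plane [W] misses [x], the span of [x] and the part of [W] orthogonal to [x] is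
    singular of dimension at least 1 + 2, hence a plane. *)
Lemma quadric_plane_through x : x \in section_quadric Q Pi ->
  exists2 p, quadric_plane Q p & x \in pts p.
Proof.
rewrite in_setI (mem_quadric quadQ) => /andP[xPi /eqP Qx].
have [W sW dW] := singular_plane_exists.
have [xW|xW] := boolP (x \in pts W).
  by exists W; rewrite // /quadric_plane dW (singular_pts quadQ).
pose U := (W :&: polarity Q x)%VS.
have sxU : totally_singular Q (x + U).
  apply/totally_singularP => v /memv_addP[_ /mem_ptP[k ->] [u + ->]]; rewrite memv_cap (orth_pt quadQ) => /andP[uW /eqP bxu].
  rewrite quadD !(quadZ quadQ) (polarZl quadQ) Qx bxu !mulr0 add0r addr0.
  by move/totally_singularP: sW; apply.
exists (x + U)%VS; last by rewrite inE addvSl.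
rewrite /quadric_plane (singular_pts quadQ) sxU andbT eqn_leq dim_singular_le3 //=.
have xU : x \notin pts U by apply: contra xW; apply/subsetP/ptsS/capvSl.
rewrite dim_addpt // ltnS.
by have := dim_cap_orth quadQ W x; rewrite dW dim_pt -/U addn1.
Qed.

(** * Types of the planes of the quadric *)

Section PlaneTypes.
Variables (O : {set point F n}) (ovO : W_ovoid Q Pi O).
Variables (p : {vspace 'rV[F]_n}) (x : point F n).
Local Notation X := (ovoid_set Q Pi O).
Hypothesis qp : quadric_plane Q p.
Hypothesis xp : x \in pts p.
Hypothesis xPi : x \in pts Pi.

Let sp : totally_singular Q p.
Proof. by move: qp; rewrite /quadric_plane (singular_pts quadQ) => /andP[]. Qed.

Let dp : \dim p = 3%N.
Proof. by case/andP: qp => /eqP. Qed.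

Lemma proj_plane : (proj @: p)%VS = tangent_plane x.
Proof.
have [y [_ ey ->]] := quadric_plane_base qp; suff -> : x = y by [].
by apply/eqP; rewrite -pt_subE ey subv_cap; move: xp xPi; rewrite !inE => -> ->.
Qed.

Lemma card_plane_ovoid_set L : (L <= p)%VS ->
  #|pts L :&: X| = #|pts (proj @: L) :&: O|.
Proof.
move=> /subvP Lp; apply: card_singular_ovoid_set => //.
by apply/totally_singularP => v /Lp; apply/totally_singularP.
Qed.

Lemma dim_proj_plane L : (L <= p)%VS -> \dim (proj @: L) = \dim L.
Proof.
move=> Lp; apply: limg_dim_eq; apply/eqP; rewrite -subv0.
by rewrite -(proj_ker_singular sp) capvS.
Qed.

Lemma base_mem_proj L : (L <= p)%VS -> (x \in pts (proj @: L)) = (x \in pts L).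
Proof.
move=> Lp; have := xp; have := xPi; rewrite !mem_pts => xPi' xp'.
apply/idP/idP => [/memv_imgP[v vL e]|xL].
  suff -> : rep x = v by [].
  by apply: (proj_inj_singular sp); rewrite // ?(subvP Lp) // -e proj_id.
by rewrite -[rep x]proj_id // memv_img.
Qed.

Lemma type_S_base : type_S Q X p = (x \in O).
Proof.
rewrite /type_S qp card_plane_ovoid_set // proj_plane card_tangent_plane //.
by case: ifP => // _; apply/eqP => -[e]; have := finNzRing_gt1 F; rewrite e.
Qed.

Lemma type_C_base : type_C Q X p = (x \notin O).
Proof.
rewrite /type_C qp /= /oval subsetIl /= card_plane_ovoid_set // proj_plane.
rewrite card_tangent_plane //; case: ifP => xO.
  by apply/negbTE; rewrite negb_and; apply/orP; left; apply/eqP => -[e]; have := finNzRing_gt1 F; rewrite -e.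
(* [oval] tests all lines of the space, so [L] is first cut down to [L :&: p]. *)
rewrite eqxx /=; apply/forall_inP => L /eqP dL; rewrite setIA -pts_cap.
rewrite card_plane_ovoid_set ?capvSr //; apply: card_line_le2 => //.
  by rewrite dim_proj_plane ?capvSr // -dL dimvS // capvSl.
by apply/subvP => _ /memv_imgP[v _ ->]; apply: proj_solid.
Qed.

(** Projection preserves the number of points. In the tangent plane, lines through [x] belong to
    W(q) and meet [O] once; conversely [tangent_through_pole] applies. *)
Lemma tangent_line_base L : x \notin O -> \dim L = 2%N -> (L <= p)%VS ->
  tangent_line p (pts p :&: X) L = (x \in pts L).
Proof.
move=> xO dL Lp; rewrite /tangent_line dL Lp eqxx /= setIA -pts_cap (capv_idPl Lp).
rewrite card_plane_ovoid_set // -base_mem_proj //.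
have LT : (proj @: L <= tangent_plane x)%VS by rewrite -proj_plane limgS.
have dL' : \dim (proj @: L) = 2%N by rewrite dim_proj_plane.
apply/eqP/idP => [|xL]; first exact: tangent_through_pole.
have [m [mx e]] := line_join dL' xL.
have [_ h] := ovO; rewrite h // -e; apply: W_line_join => //.
by rewrite inE (subv_trans _ LT) // -e addvSr.
Qed.

Lemma oval_kernel_base N : x \notin O -> oval_kernel p (pts p :&: X) N = (N == x).
Proof.
move=> xO; apply/idP/eqP => [/andP[Np /forallP h]|->]; last first.
  rewrite /oval_kernel xp; apply/forallP => L; apply/implyP => tL.
  have /and3P[/eqP dL Lp _] := tL.
  by rewrite -tangent_line_base.
have [M [xM e]] := compl_pt xp; rewrite dp => -[dM].
have [m1 m1M] : exists m, m \in pts M.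
  have v0 : vpick M != 0 by rewrite vpick0 -dimv_eq0 dM.
  by have [m em] := point_of v0; exists m; rewrite inE em -memvE memv_pick.
have [m2 [m21 eM]] := line_join dM m1M.
have m2M : m2 \in pts M by rewrite inE -eM addvSr.
have Nm m : m \in pts M -> (N <= x + m)%VS.
  move=> mM; have xm : x != m by apply: contraNneq xM => ->.
  have /implyP := h (x + m)%VS; rewrite inE; apply; rewrite tangent_line_base ?dim_join //.
    by rewrite inE addvSl.
  by rewrite -e addvS //; rewrite inE in mM.
(* If [N] differs from [x], every tangent [x + m] equals [N + x], which then contains the line [M].
   By dimension it is [M], although [x] is not on [M]. *)
apply/eqP; apply/negPn/negP => Nx.
have eN m : m \in pts M -> (N + x)%VS = (x + m)%VS.
  move=> mM; have xm : x != m by apply: contraNneq xM => ->.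
  by apply/eqP; rewrite eqEdim !dim_join // andbT subv_add Nm // addvSl.
move/negP: xM; apply; rewrite inE.
have MN : (M <= N + x)%VS.
  by rewrite -eM subv_add {1}(eN m1) // (eN m2) // !addvSr.
have /dimv_leqif_eq/geq_leqif := MN; rewrite dM dim_join // => /esym/eqP ->.
exact: addvSr.
Qed.

End PlaneTypes.

(** * Both types occur, and properties (1) and (2) *)

Lemma ovoid_set_SC O : W_ovoid Q Pi O -> O <> section_quadric Q Pi ->
  let X := ovoid_set Q Pi O in
  [/\ generalized_quadratic_SC Q X,
      forall x p, x \in A1 Q X -> quadric_plane Q p -> x \in pts p -> type_S Q X p
    & forall x p, x \in A2 Q X -> quadric_plane Q p -> x \in pts p ->
        type_C Q X p /\ oval_kernel p (pts p :&: X) x].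
Proof.
move=> ovO neqO X; have [OPi _] := ovO.
have base p : quadric_plane Q p -> exists x, [/\ x \in section_quadric Q Pi, x \in pts p & x \in pts Pi].
  move=> qp; have [x [xS ex _]] := quadric_plane_base qp.
  by exists x; split; rewrite // inE ex ?capvSl ?capvSr.
split; first split.
- by apply/subsetP => y; rewrite mem_ovoid_set // => /andP[].
- move=> p qp; have [x [_ xp xPi]] := base p qp.
  rewrite (type_S_base ovO qp xp xPi) (type_C_base ovO qp xp xPi).
  by case: (x \in O); [left | right].
- have : (0 < #|O :&: section_quadric Q Pi|)%N by rewrite odd_gt0 ?odd_ovoid_meet_quadric.
  move=> /card_gt0P[x /setIP[xO xS]]; have [p qp xp] := quadric_plane_through xS.
  by exists p; rewrite (type_S_base ovO qp xp) // (subsetP OPi).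
(* The elliptic quadric is itself an ovoid, of the same size as [O], so inclusion would force
   equality. *)
- have /subsetPn[x xS xO] : ~~ (section_quadric Q Pi \subset O).
    apply/negP => sO; apply: neqO; apply/esym/eqP; rewrite eqEcard sO.
    by rewrite (card_ovoid elliptic_ovoid) (card_ovoid ovO) leqnn.
  have [p qp xp] := quadric_plane_through xS.
  have xPi : x \in pts Pi by case/setIP: xS.
  by exists p; rewrite (type_C_base ovO qp xp xPi).
- move=> y p; rewrite inE => /andP[yX /existsP[p' /andP[tS yp']]] qp yp.
  have qp' : quadric_plane Q p' by case/andP: tS.
  have [x [xS xp' xPi]] := base p' qp'.
  have xO : x \in O by rewrite -(type_S_base ovO qp' xp' xPi).
  have xX : x \in X by rewrite in_setU in_setI xO xS orbT.
  (* The only point of the set in [p'] is its base point [x], so [y = x] lies in [O] and is also the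
     base point of [p]. *)
  have /andP[_ /cards1P[z ez]] := tS.
  have : x \in pts p' :&: X by rewrite in_setI xp'.
  have : y \in pts p' :&: X by rewrite in_setI yp'.
  rewrite ez !in_set1 => /eqP yz /eqP xz; have eyx : y = x by rewrite yz xz.
  by rewrite (type_S_base ovO qp yp) eyx.
move=> y p; rewrite inE => /existsP[p' /andP[tC ker]] qp yp.
have qp' : quadric_plane Q p' by case/andP: tC.
have [x [xS xp' xPi]] := base p' qp'.
have xO : x \notin O by rewrite -(type_C_base ovO qp' xp' xPi).
(* The kernel in [p'] is its point in [Pi], hence also the base point of any other quadric plane [p]
   through it. *)
move: ker; rewrite (oval_kernel_base ovO qp' xp' xPi) // => /eqP eyx.
rewrite eyx in yp *; split; first by rewrite (type_C_base ovO qp yp xPi).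
by rewrite (oval_kernel_base ovO qp yp xPi).
Qed.

End EllipticSolid.

Theorem theorem4p3 (F : finFieldType) (q_even : ~~ odd #|F|)
    (Q : 'rV[F]_6 -> F) (quadQ : quadratic_form Q)
    (hypQ : hyperbolic_on Q fullv)
    (Pi : {vspace 'rV[F]_6}) (dimPi : \dim Pi = 4%N)
    (ellPi : elliptic_on Q Pi)
    (O : {set point F 6}) (ovO : W_ovoid Q Pi O)
    (neqO : O <> section_quadric Q Pi) :
  let X := ovoid_set Q Pi O in
  [/\ generalized_quadratic_SC Q X,
      forall (x : point F 6) (p : {vspace 'rV[F]_6}),
        x \in A1 Q X -> quadric_plane Q p -> x \in pts p -> type_S Q X p
    & forall (x : point F 6) (p : {vspace 'rV[F]_6}),
        x \in A2 Q X -> quadric_plane Q p -> x \in pts p ->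
        type_C Q X p /\ oval_kernel p (pts p :&: X) x].
Proof.
have dimV : \dim {:'rV[F]_6} = 6%N by rewrite dimvf /dim /= mul1n.
exact: (ovoid_set_SC q_even quadQ dimPi ellPi dimV hypQ ovO neqO).
Qed.
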